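(* Let $p\ge4$ be an even integer, and let $d_0$ be a real random variable in $\mathbf L^p$, measurable with respect to $\mathcal F_0$ and such that $\mathbf E(d_0\mid\mathcal F_{-1})=0$. Let $d_i=d_0\circ T^i$ and $S_n=\sum_{i=1}^nd_i$ (setting described in the context). Then there is a constant $C_p$ depending only on $p$ such that for every positive integer $n$, $$ \mathbf E\Bigl(\max_{1\le j\le n}|S_j|^p\Bigr)\le C_p\Biggl[n\,\mathbf E(|d_1|^p)+n\Biggl(\sum_{k=1}^n\frac{1}{k^{1+4/(p(p-2))}}\|\mathbf E_0(S_k^2)\|_{p/2}^{2/(p-2)}\Biggr)^{p(p-2)/4}\Biggr]. $$
   Context: Setting: $(\Omega,\mathcal A,\mathbf P)$ is a probability space and $T:\Omega\to\Omega$ is a bijective bi-measurable transformation preserving $\mathbf P$. $\mathcal F_0\subseteq\mathcal A$ is a $\sigma$-algebra with $\mathcal F_0\subseteq T^{-1}(\mathcal F_0)$, and $\mathcal F_i=T^{-i}(\mathcal F_0)$, $i\in\mathbb Z$. Notation: $\mathbf E_0(Y)=\mathbf E(Y\mid\mathcal F_0)$ and $\|\cdot\|_p$ is the norm in $\mathbf L^p$. The constant $C_p$ does not depend on $n$ nor on the underlying random variables. *)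

(* Defs.v *)
From HB Require Import structures.
From mathcomp Require Import all_boot all_order all_algebra.
From mathcomp Require Import all_classical all_reals all_analysis.

Set Implicit Arguments.
Unset Strict Implicit.
Unset Printing Implicit Defensive.

Import Order.TTheory GRing.Theory Num.Theory.
Import numFieldNormedType.Exports.

Local Open Scope classical_set_scope.
Local Open Scope ring_scope.

(* Sub-sigma-algebras of the ambient one are represented as sets of sets,
   since the type Omega already carries the ambient sigma-algebra. *)
Definition is_sub_sigma_algebra d (Omega : measurableType d)
    (G : set (set Omega)) : Prop :=
  sigma_algebra setT G /\ G `<=` measurable.

Definition measurable_wrt d (Omega : measurableType d) (R : realType)
    (G : set (set Omega)) (f : Omega -> R) : Prop :=
  forall B : set R, measurable B -> G (f @^-1` B).

(* Y is a version of E(X | G). *)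
Definition is_cond_exp d (Omega : measurableType d) (R : realType)
    (P : probability Omega R) (G : set (set Omega)) (X Y : Omega -> R) : Prop :=
  [/\ measurable_wrt G Y,
      P.-integrable setT (EFin \o Y) &
      forall A : set Omega, G A ->
        (\int[P]_(w in A) (Y w)%:E = \int[P]_(w in A) (X w)%:E)%E].

(* T ^ i for i in Z, where Tinv is meant to be the inverse of T. *)
Definition iterz (U : Type) (T Tinv : U -> U) (i : int) : U -> U :=
  match i with
  | Posz n => iter n T
  | Negz n => iter n.+1 Tinv
  end.

(* F_i = T ^ (- i) (F_0); here T ^ (- i) (F_0) is the family of the preimages
   under T ^ i, so that F_(-1) consists of the preimages under Tinv. *)
Definition filtration (U : Type) (T Tinv : U -> U) (F0 : set (set U))
    (i : int) : set (set U) :=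
  [set iterz T Tinv i @^-1` A | A in F0].

(* S_n = d_1 + ... + d_n with d_i = d_0 \o T ^ i. *)
Definition partial_sum (U : Type) (R : realType) (T : U -> U) (d0 : U -> R)
    (n : nat) (w : U) : R :=
  \sum_(1 <= i < n.+1) d0 (iter i T w).

(* Main.v *)
(* Let q = p / 2, V_n = d_1^2 + ... + d_n^2 and N = q (q - 1).  A pathwise
   Burkholder-Davis-Gundy inequality bounds E max |S_j|^p by C E V_n^q.  Since q
   is an integer, V_2n = V_n + V_n o T^n can be expanded.  The conditional
   expectation of V_n o T^n given F_n is Z_n o T^n, where Z_n = E_0(S_n^2), so
   Hoelder's inequality reduces the mixed terms to powers of E V_n^q and of
   ||Z_n||_q.  With u^N = E V_n^q and be = ||Z_n||_q^(1 / (q - 1)) this gives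
   E V_2n^q <= 2 (u + c be)^N.  Iterating along powers of 2 produces the sum of
   2^(- l / N) ||Z_(2^l)||_q^(1 / (q - 1)), and this dyadic sum is comparable to
   the one of the theorem because ||Z_j||_q <= 2 ||Z_i||_q for j <= 2 i.
   Working with V_n instead of S_n is what doubles the exponent 1 / (p - 2):
   the expansion of S_2n^p would contain the term S_n (S_2n - S_n)^(p - 1). *)

Require Import Defs.
From HB Require Import structures.
From mathcomp Require Import all_boot all_order all_algebra.
From mathcomp Require Import all_classical all_reals all_analysis measurable_realfun.
From mathcomp Require Import ring lra zify.

Set Implicit Arguments.
Unset Strict Implicit.
Unset Printing Implicit Defensive.

Import Order.TTheory GRing.Theory Num.Theory.
Import numFieldNormedType.Exports.

Local Open Scope classical_set_scope.
Local Open Scope ring_scope.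

(** * Pathwise inequalities for real sequences *)

(** Conditioning can replace only the first power of V_n o T^n. This settles the mixed term
    V_n^(q-1) (V_n o T^n), but the opposite extreme V_n (V_n o T^n)^(q-1) has to be interpolated, by
    Hoelder's inequality with density V_n o T^n, between that term and E V_n^q. The two resulting
    bounds, u^(N-(q-1)) be^(q-1) and u^(N-1) be, have the shape of terms in a binomial expansion of
    order N; this is where N and the root 1 / (q - 1) come from. The other mixed terms are dominated
    by these two. The martingale property enters in one way only: a pathwise inequality f <= g + sum
    xi_j d_(j+1) with adapted xi_j integrates to E f <= E g. The maximal inequality and E_0(S_n^2) =
    E_0(V_n) are both obtained so, without stopping times. Conditional expectations are known only
    through their integrals over sets, so factors are pulled out of them as nonnegative weights
    under the integral. In the stationary part, q is [m.+2]. *)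

Lemma weighted_young (R : realFieldType) (m : nat) (a b : R) :
  0 <= a -> 0 <= b -> m.+1%:R * (a * b ^+ m) <= a ^+ m.+1 + m%:R * b ^+ m.+1.
Proof.
move=> a0 b0; elim: m => [|m IH]; first by rewrite !expr1 expr0; lra.
have h1 : b * (m.+1%:R * (a * b ^+ m)) <= b * (a ^+ m.+1 + m%:R * b ^+ m.+1).
  exact: ler_wpM2l.
(* After multiplication of the induction hypothesis by [b], what is missing is a b^(m+1) + b a^(m+1)
   <= a^(m+2) + b^(m+2). *)
have h2 : 0 <= (a - b) * (a ^+ m.+1 - b ^+ m.+1).
  have [ab|ba] := leP b a.
    by rewrite mulr_ge0// subr_ge0// lerXn2r.
  by rewrite mulr_le0// subr_le0 ?lerXn2r// ltW.
rewrite -!natr1 in h1 *; rewrite !exprS in h1 h2 *.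
by nra.
Qed.

(** The remainders obey r_(k+1) = y r_k + (k+2) s^(k+1) (y-s)^2, so the constant has to grow by k+2
    at each step, which (k+2)^2 allows. *)
Lemma pow_taylor1 (R : realFieldType) (k : nat) (M y s : R) :
  `|y| <= M -> `|s| <= M ->
  `|y ^+ k.+2 - s ^+ k.+2 - k.+2%:R * s ^+ k.+1 * (y - s)| <=
    (k.+2 ^ 2)%:R * M ^+ k * (y - s) ^+ 2.
Proof.
move=> yM sM.
have M0 : 0 <= M by apply: le_trans yM.
elim: k => [|k IH].
  have -> : y ^+ 2 - s ^+ 2 - 2%:R * s ^+ 1 * (y - s) = (y - s) ^+ 2 by ring.
  by rewrite ger0_norm ?sqr_ge0// expr0 mulr1 ler_peMl ?sqr_ge0// ler1n.
have -> : y ^+ k.+3 - s ^+ k.+3 - k.+3%:R * s ^+ k.+2 * (y - s) =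
    y * (y ^+ k.+2 - s ^+ k.+2 - k.+2%:R * s ^+ k.+1 * (y - s)) +
    k.+2%:R * s ^+ k.+1 * (y - s) ^+ 2.
  by rewrite -(@natr1 R k.+2) !exprS; ring.
apply: (le_trans (ler_normD _ _)).
have h1 : `|y * (y ^+ k.+2 - s ^+ k.+2 - k.+2%:R * s ^+ k.+1 * (y - s))| <=
    M * ((k.+2 ^ 2)%:R * M ^+ k * (y - s) ^+ 2).
  by rewrite normrM ler_pM.
have h2 : `|k.+2%:R * s ^+ k.+1 * (y - s) ^+ 2| <=
    k.+2%:R * M ^+ k.+1 * (y - s) ^+ 2.
  rewrite normrM [X in _ * X]ger0_norm ?sqr_ge0// normrM normrX normr_nat.
  by rewrite ler_wpM2r ?sqr_ge0// ler_wpM2l// lerXn2r ?nnegrE.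
apply: (le_trans (lerD h1 h2)).
have -> : M * ((k.+2 ^ 2)%:R * M ^+ k * (y - s) ^+ 2) +
  k.+2%:R * M ^+ k.+1 * (y - s) ^+ 2 =
  (k.+2 ^ 2 + k.+2)%:R * (M ^+ k.+1 * (y - s) ^+ 2).
  by rewrite natrD !exprS; ring.
rewrite -[leRHS]mulrA ler_wpM2r//.
  by rewrite mulr_ge0 ?sqr_ge0// exprn_ge0.
by rewrite ler_nat; nia.
Qed.

Lemma pow_add_le_linear (R : realFieldType) (a b : R) (k : nat) :
  0 <= a -> 0 <= b -> (a + b) ^+ k.+1 <= a ^+ k.+1 + k.+1%:R * b * (a + b) ^+ k.
Proof.
move=> a0 b0; elim: k => [|k IH]; first by rewrite !expr1 expr0; lra.
rewrite exprS mulrDl.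
have h1 : a * (a + b) ^+ k.+1 <= a * (a ^+ k.+1 + k.+1%:R * b * (a + b) ^+ k).
  exact: ler_wpM2l.
have h2 : 0 <= k.+1%:R * b * (b * (a + b) ^+ k).
  by rewrite !mulr_ge0// exprn_ge0// addr_ge0.
rewrite (exprS (a + b)) (exprS a) -(@natr1 R k.+1).
move: h1 h2; set X := (a + b) ^+ k; set A := a ^+ k.+1.
by rewrite (exprS (a + b)) -/X; nra.
Qed.

(** If b <= a, everything beyond a^(k+1) is at most (k+1) b (a+b)^k, and a + b <= 2 a produces the
    factor 2^k. Keeping only the two extreme mixed products suits the later estimates, which treat
    exactly these. *)
Lemma pow_add_le (R : realFieldType) (a b : R) (k : nat) : 0 <= a -> 0 <= b ->
  (a + b) ^+ k.+1 <= a ^+ k.+1 + b ^+ k.+1 +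
    (k.+1 * 2 ^ k)%:R * (a ^+ k * b + a * b ^+ k).
Proof.
wlog ba : a b / b <= a => [hw a0 b0|a0 b0].
  have [|/ltW ab] := leP b a; first by move=> ba; exact: hw.
  have := hw b a ab b0 a0; rewrite addrC [X in _ <= X + _]addrC.
  by rewrite [X in _ * X]addrC [b * _]mulrC [_ * a]mulrC.
apply: (le_trans (pow_add_le_linear k a0 b0)).
rewrite -addrA lerD2l ler_wpDl ?exprn_ge0// natrM natrX -!mulrA ler_wpM2l//.
have h : (a + b) ^+ k <= 2 ^+ k * a ^+ k.
  by rewrite -exprMn lerXn2r ?nnegrE ?addr_ge0 ?mulr_ge0//; lra.
have := ler_wpM2l b0 h; have B0 := exprn_ge0 k b0.
have c0 : 0 <= 2 ^+ k * (a * b ^+ k) by rewrite !mulr_ge0.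
by nra.
Qed.

(** Two terms of the binomial expansion; this packs the bounds of the mixed terms back into a single
    power. *)
Lemma pow_add_ge (R : realFieldType) (u x : R) (k j : nat) :
  0 <= u -> 0 <= x ->
  u ^+ (k + j.+1) + u ^+ k * x ^+ j.+1 <= (u + x) ^+ (k + j.+1).
Proof.
move=> u0 x0; rewrite !exprD -mulrDr.
apply: ler_pM; rewrite ?exprn_ge0 ?addr_ge0 ?exprn_ge0//.
  by rewrite lerXn2r ?nnegrE ?addr_ge0// lerDl.
elim: j => [|j IH]; first by rewrite !expr1.
rewrite (exprS (u + x)) (le_trans _ (ler_wpM2l (addr_ge0 u0 x0) IH))//.
have h1 := exprn_ge0 j.+1 u0; have h2 := exprn_ge0 j.+1 x0.
by rewrite (exprS u j.+1) (exprS x j.+1); nra.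
Qed.

Lemma max_mulr0 (R : realDomainType) (x y : R) : Num.max (x * y) 0 =
  Num.max x 0 * Num.max y 0 + Num.max (- x) 0 * Num.max (- y) 0.
Proof.
have pos (z : R) : 0 <= z -> Num.max z 0 = z by move=> z0; exact: max_l.
have neg (z : R) : z <= 0 -> Num.max z 0 = 0 by move=> z0; exact: max_r.
have [x0|/ltW x0] := leP 0 x; have [y0|/ltW y0] := leP 0 y.
- by rewrite (pos (x * y)) ?mulr_ge0// (neg (- x)) ?oppr_le0//
    mul0r addr0.
- by rewrite (neg (x * y)) ?mulr_ge0_le0// (neg (- x)) ?oppr_le0//
    mulr0 mul0r addr0.
- by rewrite (neg (x * y)) ?mulr_le0_ge0// (neg (- y)) ?oppr_le0//
    mulr0 mul0r addr0.
- by rewrite (pos (x * y)) ?mulr_le0// (pos (- x)) ?oppr_ge0//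
    (pos (- y)) ?oppr_ge0// mul0r add0r mulrNN.
Qed.

Lemma pow_add_le_convex (R : realDomainType) (x y : R) (k : nat) :
  0 <= x -> 0 <= y -> (x + y) ^+ k.+1 <= 2 ^+ k * (x ^+ k.+1 + y ^+ k.+1).
Proof.
move=> x0 y0; elim: k => [|k IH]; first by rewrite expr0 mul1r !expr1.
rewrite exprS (le_trans (ler_wpM2l (addr_ge0 x0 y0) IH))//.
have h : 0 <= (x - y) * (x ^+ k.+1 - y ^+ k.+1).
  have [yx|/ltW xy] := leP y x; first by rewrite mulr_ge0// subr_ge0// lerXn2r.
  by rewrite mulr_le0// subr_le0// lerXn2r.
rewrite mulrCA (exprSr 2) -mulrA ler_wpM2l ?exprn_ge0//.
by rewrite (exprS x k.+1) (exprS y k.+1); lra.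
Qed.

(** * Pathwise maximal inequality of Burkholder type *)

Section PathwiseBDG.
Variables (R : realType) (x : nat -> R).

Definition psum (n : nat) : R := \sum_(1 <= i < n.+1) x i.

Definition qvar (n : nat) : R := \sum_(1 <= i < n.+1) x i ^+ 2.

(** The recursion makes adaptedness a plain induction. The initial value 0 is |[psum 0]|, so the
    index 0 may be included in the maximum. *)
Fixpoint pmax (n : nat) : R :=
  if n is m.+1 then Num.max (pmax m) `|psum m.+1| else 0.

Lemma psum0 : psum 0 = 0. Proof. by rewrite /psum big_nil. Qed.

Lemma psumS n : psum n.+1 = psum n + x n.+1.
Proof. by rewrite /psum big_nat_recr. Qed.

Lemma qvarS n : qvar n.+1 = qvar n + x n.+1 ^+ 2.
Proof. by rewrite /qvar big_nat_recr. Qed.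

Lemma qvar_ge0 n : 0 <= qvar n.
Proof. by apply: sumr_ge0 => i _; exact: sqr_ge0. Qed.

Lemma pmax_ge0 n : 0 <= pmax n.
Proof. by elim: n => //= n IH; rewrite le_max IH. Qed.

Lemma pmax_nd n m : (n <= m)%N -> pmax n <= pmax m.
Proof.
move=> nm; rewrite -(subnK nm); elim: (m - n)%N => // k IH.
by rewrite addSn /= le_max IH.
Qed.

Lemma le_pmax n m : (n <= m)%N -> `|psum n| <= pmax m.
Proof.
move=> nm; apply: le_trans (pmax_nd nm).
by case: n {nm} => [|n]; rewrite ?psum0 ?normr0//= le_max lexx orbT.
Qed.

Lemma sqr_psum n :
  psum n ^+ 2 = qvar n + \sum_(j < n) 2 * psum j * x j.+1.
Proof.
elim: n => [|n IH].
  by rewrite psum0 /qvar big_nil big_ord0 expr0n/= addr0.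
by rewrite psumS qvarS big_ord_recr/= sqrrD IH; ring.
Qed.

(** Taylor's formula summed along the path. The remainders are bounded with the maximum at the final
    time [n], which is not adapted; this is harmless, since only the first-order terms must form a
    martingale transform. *)
Lemma pow_psum_le k n : psum n ^+ k.+2 <=
  \sum_(j < n) k.+2%:R * psum j ^+ k.+1 * x j.+1 +
  (k.+2 ^ 2)%:R * pmax n ^+ k * qvar n.
Proof.
suff H m : (m <= n)%N -> psum m ^+ k.+2 <=
    \sum_(j < m) k.+2%:R * psum j ^+ k.+1 * x j.+1 +
    (k.+2 ^ 2)%:R * pmax n ^+ k * qvar m by exact: H.
elim: m => [_|m IH mn]; first by rewrite psum0 expr0n/= big_ord0 add0r
  !mulr_ge0 ?exprn_ge0 ?pmax_ge0 ?qvar_ge0.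
have := pow_taylor1 k (le_pmax mn) (le_pmax (ltnW mn)).
move=> /(le_trans (ler_norm _)).
rewrite big_ord_recr/= qvarS mulrDr psumS.
have -> : psum m + x m.+1 - psum m = x m.+1 by ring.
by have := IH (ltnW mn); lra.
Qed.

(* Summation by parts in Doob's maximal inequality. *)
Lemma pow_pmax_le k n : k.+1%:R * pmax n ^+ k.+2 <=
  k.+2%:R * pmax n ^+ k.+1 * `|psum n| -
  \sum_(j < n) k.+2%:R * (pmax j ^+ k.+1 * Num.sg (psum j)) * x j.+1.
Proof.
elim: n => [|n IH].
  by rewrite big_ord0 psum0 normr0 !mulr0 subr0 expr0n/= mulr0.
rewrite big_ord_recr/=.
set M := pmax n in IH *; set y := `|psum n.+1|.
have M0 : 0 <= M := pmax_ge0 n.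
have y0 : 0 <= y by exact: normr_ge0.
(* Convexity of the absolute value, with the sign of [psum n] as subgradient. *)
have ys : `|psum n| + Num.sg (psum n) * x n.+1 <= y.
  rewrite /y psumS; have [s0|s0|s0] := ltgtP 0 (psum n).
  - by rewrite gtr0_norm// gtr0_sg// mul1r ler_norm.
  - by rewrite ltr0_norm// ltr0_sg// mulN1r -opprD ler_normr lexx orbT.
  - by rewrite -s0 normr0 sgr0 mul0r !add0r.
have h : k.+2%:R * M ^+ k.+1 * (`|psum n| + Num.sg (psum n) * x n.+1) <=
    k.+2%:R * M ^+ k.+1 * y.
  by rewrite ler_wpM2l// mulr_ge0 ?exprn_ge0.
(* If the maximum does not move, the induction hypothesis and [h] suffice; if it jumps to [y],
   Young's inequality for [y] and [M] compares the two maxima. *)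
have [My|yM] := leP M y; last by nra.
move: (weighted_young k.+1 y0 M0) IH h; rewrite (exprS y k.+1).
have -> : k.+2%:R = k.+1%:R + 1 :> R by rewrite natr1.
by rewrite (exprS M k.+1) => *; nra.
Qed.

(* Doob's pathwise inequality bounds pmax by psum, Taylor's formula bounds psum by
   qvar times a power of pmax, and Young's inequality absorbs that power. *)
Lemma pathwise_BDG q n : pmax n ^+ (q.+2).*2 <=
  (2 ^+ (q.+2).*2 * ((q.+2).*2 ^ 2)%:R * qvar n) ^+ q.+2 +
  \sum_(j < n) ((q.+2).*2%:R * (2 ^+ (q.+2).*2 * psum j ^+ (q.+2).*2.-1 -
     2 * (pmax j ^+ (q.+2).*2.-1 * Num.sg (psum j)))) * x j.+1.
Proof.
set k := (q.+1).*2.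
have -> : (q.+2).*2 = k.+2 by [].
rewrite [k.+2.-1]/=.
set M := pmax n; set V := qvar n; set s := psum n.
have M0 : 0 <= M := pmax_ge0 n.
have V0 : 0 <= V := qvar_ge0 n.
have h1 := pow_psum_le k n.
have h2 := pow_pmax_le k n.
have even : `|s| ^+ k.+2 = s ^+ k.+2.
  by rewrite -normrX ger0_norm// exprn_even_ge0//= negbK odd_double.
(* Young's inequality is applied to 2|s| rather than |s|, so that only half of (k+1) M^(k+2) appears
   on the right and can be absorbed. *)
have h3 : k.+2%:R * M ^+ k.+1 * `|s| <=
    (2 ^+ k.+2 * s ^+ k.+2 + k.+1%:R * M ^+ k.+2) / 2.
  have := @weighted_young _ k.+1 (2 * `|s|) M
    (mulr_ge0 (ler0n _ 2) (normr_ge0 _)) M0.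
  by rewrite exprMn even; lra.
set L := 2 ^+ k.+2 * (k.+2 ^ 2)%:R.
have L0 : 0 <= L by rewrite mulr_ge0// exprn_ge0.
(* Young's inequality between L V and M^2, with k = 2 (q+1). *)
have h4 : L * V * M ^+ k <= (L * V) ^+ q.+2 + M ^+ k.+2.
  have := @weighted_young _ q.+1 (L * V) (M ^+ 2) (mulr_ge0 L0 V0) (sqr_ge0 _).
  rewrite -!exprM !mul2n -/k -[(q.+2).*2]/(k.+2) -[q.+2%:R]natr1 => h.
  have h5 : 0 <= L * V * M ^+ k.
    by apply: mulr_ge0; [exact: mulr_ge0|exact: exprn_ge0].
  have h6 : 0 <= M ^+ k.+2 by rewrite exprn_ge0.
  have h7 : 0 <= (L * V) ^+ q.+2 by rewrite exprn_ge0// mulr_ge0.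
  have q1 : 1 <= q.+1%:R :> R by rewrite ler1n.
  rewrite -(ler_pM2l (ltr0Sn R q.+1)) -[q.+2%:R]natr1.
  by nra.
(* One copy of M^(k+2) is absorbed from [h4], and at least one must remain on the left. *)
have k1 : 2 <= k.+1%:R :> R by rewrite ler_nat.
have M1 : 0 <= M ^+ k.+2 by rewrite exprn_ge0.
have S0 : 0 <= 2 ^+ k.+2 :> R by rewrite exprn_ge0.
have := ler_wpM2l S0 h1.
under [X in _ -> _ <= _ + X]eq_bigr => j _ do rewrite mulrBr mulrBl.
rewrite sumrB -/s -/M -/V mulrDr !mulr_sumr.
under [X in _ -> _ <= _ + (_ - X)]eq_bigr => j _ do
  rewrite [_ * (2 * _)]mulrCA -mulrA.
under [X in _ -> _ <= _ + (X - _)]eq_bigr => j _ do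
  rewrite [_ * (2 ^+ _ * _)]mulrCA -mulrA.
rewrite -!mulr_sumr => h5.
have h6 : 2 ^+ k.+2 * ((k.+2 ^ 2)%:R * M ^+ k * V) = L * V * M ^+ k.
  by rewrite /L; ring.
rewrite h6 in h5.
by nra.
Qed.

End PathwiseBDG.

(** * Majorants built from the sum of the absolute values *)

Section PathwiseBounds.
Variables (R : realType) (x : nat -> R).
Local Notation D := (psum (fun i => `|x i|)).

Lemma psum_norm_nd n k : (n <= k)%N -> D n <= D k.
Proof.
move=> nk; rewrite -(subnK nk); elim: (k - n)%N => // i IH.
by rewrite addSn psumS (le_trans IH)// lerDl.
Qed.

Lemma psum_norm_ge0 n : 0 <= D n.
Proof. by rewrite /psum sumr_ge0. Qed.

Lemma norm_le_psum_norm n k : (n < k)%N -> `|x n.+1| <= D k.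
Proof.
by move=> nk; apply: le_trans (psum_norm_nd nk); rewrite psumS lerDr psum_norm_ge0.
Qed.

Lemma norm_psum_le n : `|psum x n| <= D n.
Proof. exact: ler_norm_sum. Qed.

Lemma pmax_le_psum_norm n : pmax x n <= D n.
Proof.
elim: n => [|n IH] /=; first exact: psum_norm_ge0.
by rewrite ge_max norm_psum_le (le_trans IH)// psum_norm_nd.
Qed.

Lemma qvar_le_psum_norm n : qvar x n <= D n ^+ 2.
Proof.
elim: n => [|n IH]; first by rewrite /qvar big_nil sqr_ge0.
rewrite qvarS psumS sqrrD -(@real_normK _ (x n.+1)) ?num_real//.
by have := mulr_ge0 (psum_norm_ge0 n) (normr_ge0 (x n.+1)); lra.
Qed.

End PathwiseBounds.

Lemma bigmax_psum_pmax (R : realType) (x : nat -> R) (p n : nat) :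
  \big[Num.max/0]_(1 <= j < n.+1) `|psum x j| ^+ p.+1 = pmax x n ^+ p.+1.
Proof.
apply/eqP; rewrite eq_le; apply/andP; split.
  rewrite big_nat; apply: bigmax_le => [|j /andP[_ jn]].
    by rewrite exprn_ge0// pmax_ge0.
  by rewrite lerXn2r ?nnegrE ?pmax_ge0// le_pmax.
suff H j : (j <= n)%N -> pmax x j ^+ p.+1 <=
    \big[Num.max/0]_(1 <= j < n.+1) `|psum x j| ^+ p.+1 by exact: H.
elim: j => [_|j IH jn] /=; first by rewrite expr0n/= bigmax_ge_id.
have [_|_] := leP (pmax x j) `|psum x j.+1|; last exact: IH (ltnW jn).
by apply: (@le_bigmax_seq _ _ _ _ 0 j.+1 xpredT (fun j => `|psum x j| ^+ p.+1));
  rewrite ?mem_index_iota.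
Qed.

(** * Weights measurable with respect to a sub-sigma-algebra *)

Lemma integral_indicM d (T : measurableType d) (R : realType)
    (mu : {measure set T -> \bar R}) (A : set T) (f : T -> R) :
  (\int[mu]_(x in A) (f x)%:E = \int[mu]_x (\1_A x * f x)%:E)%E.
Proof.
rewrite integral_mkcond; apply: eq_integral => x _.
rewrite patchE indicE; by case: (x \in A); rewrite ?mul1r ?mul0r.
Qed.

Lemma le_integral_finite_range d (T : measurableType d) (R : realType)
    (mu : {measure set T -> \bar R}) (a f g : T -> R) :
  finite_set (range a) -> (forall y, measurable (a @^-1` [set y])) ->
  (forall x, 0 <= a x) -> measurable_fun setT f -> measurable_fun setT g ->
  (forall x, 0 <= f x) -> (forall x, 0 <= g x) ->
  (forall y, \int[mu]_(x in a @^-1` [set y]) (f x)%:E <=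
             \int[mu]_(x in a @^-1` [set y]) (g x)%:E)%E ->
  (\int[mu]_x (a x * f x)%:E <= \int[mu]_x (a x * g x)%:E)%E.
Proof.
move=> /finite_seqP[s sE] mA a0 mf mg f0 g0 fg.
have ms x : a x \in undup s.
  by rewrite mem_undup; have : range a (a x) by [exists x]; rewrite sE.
(* Both integrals are decomposed over the level sets of [a]. The coefficient is |y| rather than y:
   they agree at every value of [a], and its sign is then immediate. *)
have E (h : T -> R) : measurable_fun setT h -> (forall x, 0 <= h x) ->
    (\int[mu]_x (a x * h x)%:E =
     \sum_(y <- undup s)
       `|y|%R%:E * \int[mu]_(x in a @^-1` [set y]) (h x)%:E)%E.
  move=> mh h0.
  pose F y x := (`|y| * (\1_(a @^-1` [set y]) x * h x))%:E.
  have mAh y : measurable_fun setT (fun x => \1_(a @^-1` [set y]) x * h x).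
    by apply: measurable_funM => //; exact: measurable_indic.
  transitivity (\int[mu]_x \sum_(y <- undup s) F y x)%E.
    apply: eq_integral => x _; rewrite (bigD1_seq (a x)) ?undup_uniq//=.
    rewrite big1 ?adde0.
      by rewrite /F indicE ger0_norm// mem_set// mul1r.
    move=> y yx; rewrite /F indicE memNset ?mul0r ?mulr0//.
    by move=> /= h1; rewrite h1 eqxx in yx.
  rewrite ge0_integral_sum//; last 2 first.
  - by move=> y; apply/measurable_EFinP; exact: measurable_funM.
  - by move=> y x _; rewrite /F lee_fin indicE !mulr_ge0.
  apply: eq_bigr => y _.
  rewrite integral_indicM -ge0_integralZl_EFin//.
  - by move=> x _; rewrite lee_fin indicE mulr_ge0.
  - exact/measurable_EFinP.
by rewrite !E//; apply: lee_sum => y _; rewrite lee_wpmul2l.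
Qed.

Section SubSigmaAlgebra.
Context d (T : measurableType d) (R : realType).
Variables (mu : {measure set T -> \bar R}) (G : set (set T)).
Hypothesis hG : is_sub_sigma_algebra G.

Lemma measurable_wrtP (f : T -> R) :
  measurable_wrt G f <->
  measurable_fun [set: g_sigma_algebraType G] (f : g_sigma_algebraType G -> R).
Proof.
have GE := measurable_g_measurableTypeE hG.1.
split=> [h _ B mB|h B mB].
  by rewrite setTI GE; exact: h.
by have := h measurableT B mB; rewrite setTI GE.
Qed.

Lemma measurable_wrt_fun (f : T -> R) : measurable_wrt G f -> measurable_fun setT f.
Proof. by move=> h _ B mB; rewrite setTI; apply/hG.2/h. Qed.

Lemma measurable_wrt_indic (A : set T) : G A -> measurable_wrt G (\1_A : T -> R).
Proof.
move=> GA; apply/measurable_wrtP; apply: measurable_indic.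
by rewrite (measurable_g_measurableTypeE hG.1).
Qed.

Lemma measurable_wrtM (f g : T -> R) : measurable_wrt G f -> measurable_wrt G g ->
  measurable_wrt G (fun x => f x * g x).
Proof.
by move=> /measurable_wrtP ? /measurable_wrtP ?; apply/measurable_wrtP;
  exact: measurable_funM.
Qed.

Lemma measurable_wrtD (f g : T -> R) : measurable_wrt G f -> measurable_wrt G g ->
  measurable_wrt G (fun x => f x + g x).
Proof.
by move=> /measurable_wrtP ? /measurable_wrtP ?; apply/measurable_wrtP;
  exact: measurable_funD.
Qed.

Lemma measurable_wrt_max (f g : T -> R) : measurable_wrt G f -> measurable_wrt G g ->
  measurable_wrt G (fun x => Num.max (f x) (g x)).
Proof.
by move=> /measurable_wrtP ? /measurable_wrtP ?; apply/measurable_wrtP;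
  exact: measurable_maxr.
Qed.

Lemma measurable_wrt_comp (h : R -> R) (f : T -> R) : measurable_fun setT h ->
  measurable_wrt G f -> measurable_wrt G (h \o f).
Proof.
by move=> mh /measurable_wrtP ?; apply/measurable_wrtP; exact: measurableT_comp.
Qed.

Lemma measurable_wrt_cst (r : R) : measurable_wrt G (fun=> r).
Proof. by apply/measurable_wrtP; exact: measurable_cst. Qed.

Import HBNNSimple.

Lemma le_integral_weight (f g z : T -> R) :
  measurable_fun setT f -> measurable_fun setT g -> (forall x, 0 <= f x) ->
  (forall x, 0 <= g x) -> (forall x, 0 <= z x) -> measurable_wrt G z ->
  (forall A, G A ->
    (\int[mu]_(x in A) (f x)%:E <= \int[mu]_(x in A) (g x)%:E)%E) ->
  (\int[mu]_x (z x * f x)%:E <= \int[mu]_x (z x * g x)%:E)%E.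
Proof.
move=> mf mg f0 g0 z0 Gz fg.
have mz : measurable_fun setT z := measurable_wrt_fun Gz.
have GE := measurable_g_measurableTypeE hG.1.
pose T' : measurableType _ := g_sigma_algebraType G.
have mz' : measurable_fun [set: T'] (EFin \o z : T' -> \bar R).
  by apply/measurable_EFinP/measurable_wrtP.
(* The simple functions are built on the space carrying [G], so that their level sets lie in [G];
   they are then integrated over the ambient space. *)
pose a n : {nnsfun T' >-> R} := nnsfun_approx measurableT mz' n.
have acvg x : ((a n x)%:E @[n --> \oo] --> (z x)%:E)%E.
  by apply: (cvg_nnsfun_approx measurableT mz') => //= y _; rewrite lee_fin.
have and_ x : nondecreasing_seq (a ^~ x).
  by move=> n m nm; exact/lefP/nd_nnsfun_approx.
have Ga n : measurable_wrt G (a n).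
  by apply/measurable_wrtP; exact: measurable_funP.
have ma n : measurable_fun setT (a n : T -> R) := measurable_wrt_fun (Ga n).
have az n x : a n x <= z x.
  rewrite -lee_fin -(cvg_lim _ (acvg x))//.
  apply: lime_ge; first by apply/cvg_ex; eexists; exact: acvg.
  by exists n => // m /= nm; rewrite lee_fin; exact: and_.
have fin n : (\int[mu]_x (a n x * f x)%:E <= \int[mu]_x (z x * g x)%:E)%E.
  apply: (@le_trans _ _ (\int[mu]_x (a n x * g x)%:E)%E).
    have range_fin : finite_set (range (a n : T -> R)) by exact: (@fimfunP T' R (a n)).
    have Gy y : G ((a n : T -> R) @^-1` [set y]).
      by apply: (Ga n); exact: measurable_set1.
    apply: (le_integral_finite_range range_fin) => // y; last exact: fg.
    exact: hG.2.
  apply: ge0_le_integral => //.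
  - by move=> x _; rewrite lee_fin mulr_ge0.
  - by apply/measurable_EFinP/measurable_funM.
  - by apply/measurable_EFinP/measurable_funM.
  - by move=> x _; rewrite lee_fin ler_wpM2r.
have cv : ((\int[mu]_x (a n x * f x)%:E)%E @[n --> \oo] -->
    (\int[mu]_x (z x * f x)%:E)%E)%E.
  have -> : (\int[mu]_x (z x * f x)%:E =
      \int[mu]_x (limn (fun n => (a n x * f x)%:E)))%E.
    apply: eq_integral => x _; apply/esym/cvg_lim => //.
    have ffin : (f x)%:E \is a fin_num by [].
    exact: (cvgeZr ffin (acvg x)).
  apply: (@cvg_monotone_convergence _ _ _ mu _ _ (fun n x => (a n x * f x)%:E)) => //.
  - by move=> n; apply/measurable_EFinP/measurable_funM.
  - by move=> n x _; rewrite lee_fin mulr_ge0.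
  - by move=> x _ n m nm; rewrite lee_fin ler_wpM2r//; exact: and_.
rewrite -(cvg_lim _ cv)//; apply: lime_le; last exact: nearW.
by apply/cvg_ex; eexists; exact: cv.
Qed.

Lemma eq_integral_weight (f g z : T -> R) :
  measurable_fun setT f -> measurable_fun setT g -> (forall x, 0 <= f x) ->
  (forall x, 0 <= g x) -> (forall x, 0 <= z x) -> measurable_wrt G z ->
  (forall A, G A ->
    (\int[mu]_(x in A) (f x)%:E = \int[mu]_(x in A) (g x)%:E)%E) ->
  (\int[mu]_x (z x * f x)%:E = \int[mu]_x (z x * g x)%:E)%E.
Proof.
move=> mf mg f0 g0 z0 Gz fg; apply/eqP; rewrite eq_le !le_integral_weight//.
  by move=> A GA; rewrite fg.
by move=> A GA; rewrite fg.
Qed.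

End SubSigmaAlgebra.

(** * Hoelder and Jensen inequalities for natural powers *)

Lemma ge0_le_integral_real d (T : measurableType d) (R : realType)
    (mu : {measure set T -> \bar R}) (f g : T -> R) :
  measurable_fun setT f -> measurable_fun setT g -> (forall x, 0 <= f x) ->
  (forall x, f x <= g x) -> (\int[mu]_x (f x)%:E <= \int[mu]_x (g x)%:E)%E.
Proof.
move=> mf mg f0 fg; apply: ge0_le_integral => //.
- by move=> x _; rewrite lee_fin.
- exact/measurable_EFinP.
- exact/measurable_EFinP.
- by move=> x _; rewrite lee_fin.
Qed.

Lemma ge0_integralD_real d (T : measurableType d) (R : realType)
    (mu : {measure set T -> \bar R}) (f g : T -> R) :
  measurable_fun setT f -> measurable_fun setT g -> (forall x, 0 <= f x) ->
  (forall x, 0 <= g x) ->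
  (\int[mu]_x (f x + g x)%:E = \int[mu]_x (f x)%:E + \int[mu]_x (g x)%:E)%E.
Proof.
move=> mf mg f0 g0; under eq_integral do rewrite EFinD.
apply: ge0_integralD => //.
- by move=> x _; rewrite lee_fin.
- exact/measurable_EFinP.
- by move=> x _; rewrite lee_fin.
- exact/measurable_EFinP.
Qed.

Lemma ge0_integralZl_real d (T : measurableType d) (R : realType)
    (mu : {measure set T -> \bar R}) (k : R) (f : T -> R) :
  measurable_fun setT f -> (forall x, 0 <= f x) -> 0 <= k ->
  (\int[mu]_x (k * f x)%:E = k%:E * \int[mu]_x (f x)%:E)%E.
Proof.
move=> mf f0 k0; rewrite -ge0_integralZl_EFin//.
- by move=> x _; rewrite lee_fin.
- exact/measurable_EFinP.
Qed.

Section Hoelder.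
Context d (T : measurableType d) (R : realType).
Variables (mu : {measure set T -> \bar R}) (f g h : T -> R) (m : nat).
Hypotheses (mf : measurable_fun setT f) (mg : measurable_fun setT g)
  (mh : measurable_fun setT h) (f0 : forall x, 0 <= f x)
  (g0 : forall x, 0 <= g x) (h0 : forall x, 0 <= h x).

Let hoelder_pow_gt0 (al be : R) : 0 < al -> 0 < be ->
  (\int[mu]_x (f x ^+ m.+1 * h x)%:E <= (al ^+ m.+1)%:E)%E ->
  (\int[mu]_x (g x ^+ m.+1 * h x)%:E <= (be ^+ m.+1)%:E)%E ->
  (\int[mu]_x (f x * g x ^+ m * h x)%:E <= (al * be ^+ m)%:E)%E.
Proof.
move=> al0 be0 fal gbe.
have al1 : 0 < al ^+ m.+1 by rewrite exprn_gt0.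
have be1 : 0 < be ^+ m.+1 by rewrite exprn_gt0.
have be2 : 0 < be ^+ m by rewrite exprn_gt0.
have m1 : 0 < m.+1%:R :> R by rewrite ltr0n.
(* Coefficients of Young's inequality for f/al and g/be, multiplied by al be^m; they satisfy c1
   al^(m+1) + c2 be^(m+1) = al be^m. *)
pose c1 := al * be ^+ m / (m.+1%:R * al ^+ m.+1).
pose c2 := al * be ^+ m * m%:R / (m.+1%:R * be ^+ m.+1).
have c10 : 0 <= c1 by rewrite divr_ge0// mulr_ge0// ltW.
have c20 : 0 <= c2.
  by rewrite divr_ge0// mulr_ge0// ?(mulr_ge0 (ltW al0))// ltW.
have young x : f x * g x ^+ m * h x <=
    c1 * (f x ^+ m.+1 * h x) + c2 * (g x ^+ m.+1 * h x).
  have := weighted_young m (divr_ge0 (f0 x) (ltW al0)) (divr_ge0 (g0 x) (ltW be0)).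
  rewrite !expr_div_n => y1.
  have -> : c1 * (f x ^+ m.+1 * h x) + c2 * (g x ^+ m.+1 * h x) =
      al * be ^+ m / m.+1%:R * h x * (f x ^+ m.+1 / al ^+ m.+1 +
         m%:R * (g x ^+ m.+1 / be ^+ m.+1)).
    by rewrite /c1 /c2; field; rewrite !gt_eqF.
  have -> : f x * g x ^+ m * h x = al * be ^+ m / m.+1%:R * h x *
      (m.+1%:R * (f x / al * (g x ^+ m / be ^+ m))).
    by field; rewrite !gt_eqF.
  by rewrite ler_wpM2l// mulr_ge0// divr_ge0// mulr_ge0// ltW.
have mfh k : measurable_fun setT (fun x => f x ^+ k * h x).
  by apply: measurable_funM => //; exact: measurable_funX.
have fh0 k x : 0 <= f x ^+ k * h x by apply: mulr_ge0 => //; exact: exprn_ge0.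
have mgh k : measurable_fun setT (fun x => g x ^+ k * h x).
  by apply: measurable_funM => //; exact: measurable_funX.
have gh0 k x : 0 <= g x ^+ k * h x by apply: mulr_ge0 => //; exact: exprn_ge0.
apply: (@le_trans _ _ (\int[mu]_x (c1 * (f x ^+ m.+1 * h x) +
    c2 * (g x ^+ m.+1 * h x))%:E)%E).
  apply: ge0_le_integral_real => //.
  - apply: measurable_funM => //; apply: measurable_funM => //.
    exact: measurable_funX.
  - by apply: measurable_funD; exact: measurable_funM.
  - by move=> x; rewrite mulr_ge0 ?mulr_ge0 ?exprn_ge0.
rewrite ge0_integralD_real//; last 4 first.
- exact: measurable_funM.
- exact: measurable_funM.
- by move=> x; rewrite mulr_ge0.
- by move=> x; rewrite mulr_ge0.
rewrite !ge0_integralZl_real//.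
apply: (@le_trans _ _ (c1%:E * (al ^+ m.+1)%:E + c2%:E * (be ^+ m.+1)%:E)%E).
  by apply: leeD; rewrite lee_wpmul2l.
rewrite -!EFinM -EFinD lee_fin le_eqVlt; apply/orP; left; apply/eqP.
rewrite /c1 /c2 -(@natr1 R m); field.
by rewrite natr1 !gt_eqF.
Qed.

(** Exponents m+1 and (m+1)/m, for the measure with density [h]. Stating it with numerical bounds
    [al] and [be] avoids roots of integrals. Normalization fails when a bound is 0, so both are
    perturbed by [harmonic n], which then tends to 0. *)
Lemma hoelder_pow (al be : R) : 0 <= al -> 0 <= be ->
  (\int[mu]_x (f x ^+ m.+1 * h x)%:E <= (al ^+ m.+1)%:E)%E ->
  (\int[mu]_x (g x ^+ m.+1 * h x)%:E <= (be ^+ m.+1)%:E)%E ->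
  (\int[mu]_x (f x * g x ^+ m * h x)%:E <= (al * be ^+ m)%:E)%E.
Proof.
move=> al0 be0 fal gbe.
have ub (n : nat) : (\int[mu]_x (f x * g x ^+ m * h x)%:E <=
    ((al + harmonic n) * (be + harmonic n) ^+ m)%:E)%E.
  have hn : 0 < harmonic n :> R by exact: harmonic_gt0.
  apply: hoelder_pow_gt0; rewrite ?ltr_wpDl//.
    apply: (le_trans fal); rewrite lee_fin lerXn2r ?nnegrE ?lerDl ?addr_ge0//;
    exact: ltW.
  apply: (le_trans gbe); rewrite lee_fin lerXn2r ?nnegrE ?lerDl ?addr_ge0//;
  exact: ltW.
have cv : ((al + harmonic n) * (be + harmonic n) ^+ m)%:E @[n --> \oo] -->
    (al * be ^+ m)%:E.
  apply: cvg_EFin; first exact: nearW.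
  rewrite -{2}(addr0 al) -{2}(addr0 be).
  apply: cvgM; first by apply: cvgD; [exact: cvg_cst|exact: cvg_harmonic].
  apply: (@cvg_comp _ _ _ (fun n : nat => be + harmonic n) (fun x => x ^+ m));
    last exact: exprn_continuous.
  by apply: cvgD; [exact: cvg_cst|exact: cvg_harmonic].
rewrite -(cvg_lim _ cv)//; apply: lime_ge; last exact: nearW.
by apply/cvg_ex; eexists; exact: cv.
Qed.

End Hoelder.

(* Jensen's inequality for Z <= E(Y | G).  Truncating Z makes both sides of
   Young's inequality Y g^m <= ... finite, so that the power of g cancels. *)
Lemma le_integral_cond_exp_pow d (T : measurableType d) (R : realType)
    (P : probability T R) (G : set (set T)) (Y Z : T -> R) (m : nat) :
  is_sub_sigma_algebra G -> measurable_fun setT Y -> measurable_wrt G Z ->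
  (forall x, 0 <= Y x) -> (forall x, 0 <= Z x) ->
  (forall A, G A -> \int[P]_(x in A) (Z x)%:E <= \int[P]_(x in A) (Y x)%:E)%E ->
  (\int[P]_x (Z x ^+ m.+1)%:E <= \int[P]_x (Y x ^+ m.+1)%:E)%E.
Proof.
move=> hG mY GZ Y0 Z0 ZY.
have mZ : measurable_fun setT Z := measurable_wrt_fun hG GZ.
pose g (n : nat) x := Num.min (Z x) n%:R.
have g0 n x : 0 <= g n x by rewrite /g le_min Z0/=.
have gZ n x : g n x <= Z x by rewrite /g ge_min lexx.
have Gg n : measurable_wrt G (g n).
  apply: (@measurable_wrt_comp _ _ _ _ hG (fun y => Num.min y n%:R)) => //.
  exact: measurable_minr.
have mg n : measurable_fun setT (g n) := measurable_wrt_fun hG (Gg n).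
have mX (h : T -> R) k : measurable_fun setT h ->
  measurable_fun setT (fun x => h x ^+ k) by exact: measurable_funX.
have X0 (h : T -> R) k : (forall x, 0 <= h x) -> forall x, 0 <= h x ^+ k.
  by move=> h0 x; rewrite exprn_ge0.
have step n : (\int[P]_x (g n x ^+ m.+1)%:E <= \int[P]_x (Y x ^+ m.+1)%:E)%E.
  have gfin : (\int[P]_x (g n x ^+ m.+1)%:E \is a fin_num)%E.
    rewrite ge0_fin_numE; last by apply: integral_ge0 => x _; rewrite lee_fin X0.
    apply: (@le_lt_trans _ _ (\int[P]_x (n%:R ^+ m.+1)%:E)%E).
      apply: ge0_le_integral_real => //; first exact: mX.
        by move=> x; exact: X0.
      move=> x; rewrite lerXn2r ?nnegrE//.
      by rewrite /g ge_min lexx orbT.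
    rewrite (integral_cst P measurableT) [X in (_ * X)%E](_ : _ = 1%E) ?mule1 ?ltry//.
    exact: probability_setT.
  (* Only one factor [g n] is enlarged to [Z]; the remaining power is a [G]-measurable weight, under
     which [Z] may be replaced by [Y]. *)
  have h1 : (\int[P]_x (g n x ^+ m.+1)%:E <= \int[P]_x (g n x ^+ m * Y x)%:E)%E.
    apply: (@le_trans _ _ (\int[P]_x (g n x ^+ m * Z x)%:E)%E).
      apply: ge0_le_integral_real => //; first exact: mX.
      - by apply: measurable_funM => //; exact: mX.
      - exact: X0.
      - by move=> x; rewrite exprSr ler_wpM2l// X0.
    apply: (le_integral_weight hG) => //; first exact: X0.
    exact: (@measurable_wrt_comp _ _ _ _ hG (fun y => y ^+ m)).
  have h2 : (m.+1%:R%:E * \int[P]_x (g n x ^+ m * Y x)%:E <=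
      \int[P]_x (Y x ^+ m.+1)%:E + m%:R%:E * \int[P]_x (g n x ^+ m.+1)%:E)%E.
    rewrite -!ge0_integralZl_real//; last 4 first.
    - exact: mX.
    - exact: X0.
    - by apply: measurable_funM => //; exact: mX.
    - by move=> x; rewrite mulr_ge0// X0.
    rewrite -ge0_integralD_real//; last 4 first.
    - exact: mX.
    - by apply: measurable_funM => //; exact: mX.
    - exact: X0.
    - by move=> x; rewrite mulr_ge0// X0.
    apply: ge0_le_integral_real => //.
    - by do 2 apply: measurable_funM => //; exact: mX.
    - apply: measurable_funD => //; first exact: mX.
      by apply: measurable_funM => //; exact: mX.
    - by move=> x; rewrite !mulr_ge0// X0.
    - by move=> x; rewrite [_ ^+ m * _]mulrC; exact: weighted_young.
  have [yfin|] := boolP (\int[P]_x (Y x ^+ m.+1)%:E < +oo)%E; last first.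
    by rewrite -leNgt leye_eq => /eqP ->; rewrite leey.
  have Yfin : (\int[P]_x (Y x ^+ m.+1)%:E \is a fin_num)%E.
    rewrite ge0_fin_numE//.
    by apply: integral_ge0 => x _; rewrite lee_fin X0.
  have h3 : (m.+1%:R%:E * \int[P]_x (g n x ^+ m.+1)%:E <=
      \int[P]_x (Y x ^+ m.+1)%:E + m%:R%:E * \int[P]_x (g n x ^+ m.+1)%:E)%E.
    by apply: le_trans h2; rewrite lee_wpmul2l.
  move: h3; rewrite -(fineK gfin) -(fineK Yfin) -!EFinM -EFinD !lee_fin.
  by rewrite -(@natr1 R m); lra.
have cv : ((\int[P]_x (g n x ^+ m.+1)%:E)%E @[n --> \oo] -->
    (\int[P]_x (Z x ^+ m.+1)%:E)%E)%E.
  have -> : (\int[P]_x (Z x ^+ m.+1)%:E =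
      \int[P]_x (limn (fun n => (g n x ^+ m.+1)%:E)))%E.
    apply: eq_integral => x _; apply/esym/cvg_lim => //.
    apply: (@cvg_near_cst _ _ _ _ _ _ _).
    near=> n; rewrite /g min_l//.
    apply: ltW; near: n; exact: nbhs_infty_gtr.
  apply: (@cvg_monotone_convergence _ _ _ P _ _ (fun n x => (g n x ^+ m.+1)%:E)) => //.
  - by move=> n; apply/measurable_EFinP; exact: mX.
  - by move=> n x _; rewrite lee_fin X0.
  - move=> x _ n k nk; rewrite lee_fin lerXn2r ?nnegrE//.
    by rewrite /g le_min !ge_min lexx/= ler_nat nk orbT.
rewrite -(cvg_lim _ cv)//; apply: lime_le; last exact: nearW.
by apply/cvg_ex; eexists; exact: cv.
Unshelve. all: by end_near. Qed.

(** * The dyadic recursion *)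

Section DyadicRecursion.
Variables (R : realType) (m : nat).
Let N := (m.+2 * m.+1)%N.
Let rho : R := 2 `^ N%:R^-1.
Variables (c A : R) (w b : nat -> R).
Hypotheses (c0 : 0 <= c) (A0 : 0 <= A) (b0 : forall k, 0 <= b k) (w0 : w 0 <= A).
Hypothesis wS : forall l u be, 0 <= u -> 0 <= be -> w l <= u ^+ N ->
  b (2 ^ l) ^+ m.+2 <= be ^+ N -> w l.+1 <= 2 * (u + c * be) ^+ N.
Hypothesis b_double : forall j k, (0 < k)%N -> (j <= k.*2)%N -> b j <= 2 * b k.

Let rho_gt0 : 0 < rho. Proof. exact: powR_gt0. Qed.

Let rhoN : rho ^+ N = 2.
Proof. by rewrite -powR_mulrn ?powR_ge0// -powRrM mulVf ?powRr1// pnatr_eq0. Qed.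

(** For N-th roots the recursion becomes the linear one u_(l+1) <= rho (u_l + c be_l) with rho^N =
    2, which is unrolled after division by rho^l. *)
Lemma dyadic_recursion r : w r <= 2 ^+ r *
  (A `^ N%:R^-1 + c * \sum_(l < r) rho ^- l * b (2 ^ l) `^ m.+1%:R^-1) ^+ N.
Proof.
pose S r := \sum_(l < r) rho ^- l * b (2 ^ l) `^ m.+1%:R^-1.
have S0 k : 0 <= S k.
  by apply: sumr_ge0 => l _; rewrite mulr_ge0 ?powR_ge0// invr_ge0 exprn_ge0// ltW.
rewrite -/(S r) -rhoN -exprM mulnC exprM -exprMn.
elim: r => [|r IH].
  rewrite expr0 mul1r /S big_ord0 mulr0 addr0 -powR_mulrn ?powR_ge0//.
  by rewrite -powRrM mulVf ?powRr1// pnatr_eq0.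
have := wS _ (powR_ge0 (b (2 ^ r)) m.+1%:R^-1) IH.
move=> /(_ (mulr_ge0 (exprn_ge0 _ (ltW rho_gt0))
  (addr_ge0 (powR_ge0 _ _) (mulr_ge0 c0 (S0 r))))).
have -> : (b (2 ^ r) `^ m.+1%:R^-1) ^+ N = b (2 ^ r) ^+ m.+2.
  rewrite -powR_mulrn ?powR_ge0// -powRrM /N natrM mulrCA mulVf ?mulr1 ?pnatr_eq0//.
  by rewrite powR_mulrn.
move=> /(_ (lexx _)) /le_trans; apply.
rewrite -rhoN -exprMn exprS /S big_ord_recr/= -/(S r).
rewrite le_eqVlt; apply/predU1P; left; congr (_ ^+ _); field.
by rewrite lt0r_neq0// exprn_gt0.
Qed.

(** The block 2^r < k <= 2^(r+1) has 2^r terms, each at least 1 / (4 * 2^r) times the dyadic term of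
    index r+1: one factor 1/2 comes from k <= 2^(r+1), the other from [b_double] applied to 2^(r+1)
    <= 2 k. *)
Lemma dyadic_sum_le r :
  \sum_(l < r.+1) rho ^- l * b (2 ^ l) `^ m.+1%:R^-1 <=
  4 * \sum_(1 <= k < (2 ^ r).+1) (k%:R `^ (1 + N%:R^-1))^-1 * b k `^ m.+1%:R^-1.
Proof.
pose t k : R := (k%:R `^ (1 + N%:R^-1))^-1 * b k `^ m.+1%:R^-1.
elim: r => [|r IH].
  rewrite big_ord_recl big_ord0 big_nat1 expr0 invr1 mul1r powR1 invr1 mul1r addr0.
  by rewrite ler_peMl ?powR_ge0// ler1n.
rewrite big_ord_recr/= (@big_cat_nat _ _ _ (2 ^ r).+1)//=; last first.
  by rewrite ltnS leq_exp2l.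
rewrite mulrDr lerD//.
have tk k : (2 ^ r < k <= 2 ^ r.+1)%N ->
    (2 ^+ r)^-1 / 4 * (rho ^- r.+1 * b (2 ^ r.+1) `^ m.+1%:R^-1) <= t k.
  move=> /andP[rk kr].
  have k0 : (0 < k)%N by apply: leq_ltn_trans rk.
  have e1 : k%:R `^ (1 + N%:R^-1) <= 2 ^+ r.+1 * rho ^+ r.+1.
    apply: (@le_trans _ _ ((2 ^ r.+1)%:R `^ (1 + N%:R^-1))).
      by rewrite ge0_ler_powR ?nnegrE ?addr_ge0 ?invr_ge0// ler_nat.
    rewrite powRD; last by rewrite pnatr_eq0 expn_eq0 implybT.
    rewrite powRr1// natrX ler_wpM2l// /rho -powR_mulrn// -powRrM.
    by rewrite -[X in _ <= X]powR_mulrn ?powR_ge0// -powRrM mulrC.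
  have e2 : b (2 ^ r.+1) `^ m.+1%:R^-1 <= 2 * b k `^ m.+1%:R^-1.
    apply: (@le_trans _ _ ((2 * b k) `^ m.+1%:R^-1)).
      rewrite ge0_ler_powR ?nnegrE ?invr_ge0// ?mulr_ge0//.
      by apply: b_double => //; rewrite expnS mul2n leq_double ltnW.
    rewrite powRM// ler_wpM2r ?powR_ge0//.
    by rewrite -[leRHS]powRr1// ler_powR ?ler1n// invf_le1 ?ler1n.
  have kp : 0 < k%:R `^ (1 + N%:R^-1) :> R by rewrite powR_gt0 ?ltr0n.
  have e3 : (2 ^+ r.+1 * rho ^+ r.+1)^-1 <= (k%:R `^ (1 + N%:R^-1))^-1.
    by rewrite lef_pV2 ?posrE// mulr_gt0 ?exprn_gt0.
  apply: (@le_trans _ _ ((2 ^+ r.+1 * rho ^+ r.+1)^-1 * b k `^ m.+1%:R^-1)).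
    have -> : (2 ^+ r.+1 * rho ^+ r.+1)^-1 * b k `^ m.+1%:R^-1 =
        (2 ^+ r)^-1 / 4 * (rho ^- r.+1 * (2 * b k `^ m.+1%:R^-1)).
      by rewrite (exprS 2 r); field; rewrite !lt0r_neq0 ?exprn_gt0.
    rewrite ler_wpM2l ?divr_ge0 ?invr_ge0 ?exprn_ge0//.
    by rewrite ler_wpM2l// invr_ge0 exprn_ge0// ltW.
  by rewrite ler_wpM2r// powR_ge0.
set s := _ * b (2 ^ r.+1) `^ _ in tk *.
rewrite (@le_trans _ _ (4 * \sum_((2 ^ r).+1 <= k < (2 ^ r.+1).+1)
    ((2 ^+ r)^-1 / 4 * s)))//; last first.
  by rewrite ler_wpM2l//; apply: ler_sum_nat => k; exact: tk.
rewrite sumr_const_nat subSS expnS mul2n -addnn addnK -[_ *+ (2 ^ r)]mulr_natl natrX.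
rewrite le_eqVlt; apply/predU1P; left; field.
by rewrite lt0r_neq0// exprn_gt0.
Qed.

End DyadicRecursion.

(** * Stationary martingale differences *)

Lemma measurable_sgr (R : realType) : measurable_fun setT (@Num.sg R).
Proof.
rewrite (_ : Num.sg = fun x => \1_`]0, +oo[ x - \1_`]-oo, 0[ x); last first.
  apply/funext => x; rewrite !indicE !mem_setE !in_itv/= andbT.
  have [x0|x0|<-] := ltgtP 0 x; first by rewrite gtr0_sg// subr0.
    by rewrite ltr0_sg// sub0r.
  by rewrite sgr0 subr0.
by apply: measurable_funB; apply: measurable_indic.
Qed.

Lemma indic_preimage (R : realType) (U V : Type) (f : U -> V) (A : set V) x :
  \1_(f @^-1` A) x = \1_A (f x) :> R.
Proof. by rewrite !indicE; congr (_%:R); apply/idP/idP; rewrite !inE. Qed.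

Section StationaryMartingale.
Context (R : realType) (disp : measure_display) (Omega : measurableType disp).
Variables (P : probability Omega R) (T Tinv : Omega -> Omega).
Variables (F0 : set (set Omega)) (d0 : Omega -> R) (m : nat).
Hypotheses (TK : cancel T Tinv) (mT : measurable_fun setT T)
  (mTinv : measurable_fun setT Tinv).
Hypothesis PT : forall A : set Omega, measurable A -> P (T @^-1` A) = P A.
Hypothesis hF0 : is_sub_sigma_algebra F0.
Hypothesis F0T : F0 `<=` filtration T Tinv F0 1.
Hypothesis F0d0 : measurable_wrt F0 d0.

Definition shifted_sigma_algebra (n : nat) : set (set Omega) :=
  [set iter n T @^-1` A | A in F0].

Local Notation Fil := shifted_sigma_algebra.
Local Notation d i := (fun w => d0 (iter i T w)).

Lemma measurable_iter n : measurable_fun setT (iter n T).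
Proof.
elim: n => [|n IH]; first exact: measurable_id.
exact: (measurableT_comp mT IH).
Qed.

Lemma integral_iter n (f : Omega -> R) : measurable_fun setT f ->
  (forall w, 0 <= f w) ->
  (\int[P]_w (f (iter n T w))%:E = \int[P]_w (f w)%:E)%E.
Proof.
elim: n f => // n IH f mf f0.
rewrite (IH (f \o T))//=; last exact: measurableT_comp.
transitivity (\int[pushforward P T]_w (f w)%:E)%E.
  rewrite (@ge0_integral_pushforward _ _ _ _ _ T mT P setT (EFin \o f))//.
  - exact/measurable_EFinP.
  - by move=> w _; rewrite lee_fin.
apply: eq_measure_integral => A mA _; exact: PT.
Qed.

Lemma integral_iter_preimage n (B : set Omega) (f : Omega -> R) : measurable B ->
  measurable_fun setT f -> (forall w, 0 <= f w) ->
  (\int[P]_(w in iter n T @^-1` B) (f (iter n T w))%:E =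
   \int[P]_(w in B) (f w)%:E)%E.
Proof.
move=> mB mf f0; rewrite integral_indicM [RHS]integral_indicM.
under eq_integral do rewrite indic_preimage.
apply: (@integral_iter n (fun w => \1_B w * f w)).
  by apply: measurable_funM => //; exact: measurable_indic.
by move=> w; rewrite indicE mulr_ge0.
Qed.

Lemma shifted_sub_sigma_algebra n : is_sub_sigma_algebra (Fil n).
Proof.
split.
  have -> : Fil n = preimage_set_system setT (iter n T) F0.
    by apply/seteqP; split=> _ [A FA <-]; exists A => //; rewrite setTI.
  exact/sigma_algebra_preimage/hF0.1.
move=> _ [A FA <-]; rewrite -[_ @^-1` _]setTI.
by apply: measurable_iter => //; exact: hF0.2.
Qed.

Let FilP := shifted_sub_sigma_algebra.

Lemma shifted_sigma_algebra_nd i n : (i <= n)%N -> Fil i `<=` Fil n.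
Proof.
move=> /subnK <-; elim: (n - i)%N => // k IH A /IH [B FB <-].
by have [B' FB' <-] := F0T FB; exists B'.
Qed.

Lemma measurable_wrt_nd i n (f : Omega -> R) : (i <= n)%N ->
  measurable_wrt (Fil i) f -> measurable_wrt (Fil n) f.
Proof. by move=> le_in h B mB; apply: (shifted_sigma_algebra_nd le_in); exact: h. Qed.

Lemma measurable_wrt_shift n (f : Omega -> R) : measurable_wrt F0 f ->
  measurable_wrt (Fil n) (fun w => f (iter n T w)).
Proof. by move=> h B mB; exists (f @^-1` B) => //; exact: h. Qed.

Lemma measurable_wrt_psum (f : Omega -> R) n j : measurable_wrt F0 f ->
  (j <= n)%N -> measurable_wrt (Fil n) (fun w => psum (fun i => f (iter i T w)) j).
Proof.
move=> F0f; elim: j => [_|j IH jn].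
  rewrite (_ : (fun _ => _) = fun=> 0); last by apply/funext => w; rewrite psum0.
  exact: measurable_wrt_cst.
rewrite (_ : (fun _ => _) = fun w =>
  psum (fun i => f (iter i T w)) j + f (iter j.+1 T w)); last first.
  by apply/funext => w; rewrite psumS.
apply: (measurable_wrtD (FilP n)); first exact: IH (ltnW jn).
by apply: (measurable_wrt_nd jn); exact: measurable_wrt_shift.
Qed.

Lemma measurable_wrt_pmax n j : (j <= n)%N ->
  measurable_wrt (Fil n) (fun w => pmax (fun i => d0 (iter i T w)) j).
Proof.
elim: j => [_|j IH jn] /=; first exact: measurable_wrt_cst.
apply: (measurable_wrt_max (FilP n)); first exact: IH (ltnW jn).
apply: (@measurable_wrt_comp _ _ _ _ (FilP n) Num.norm); first exact: normr_measurable.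
exact: measurable_wrt_psum.
Qed.

Lemma measurable_wrt_qvar n j : (j <= n)%N ->
  measurable_wrt (Fil n) (fun w => qvar (fun i => d0 (iter i T w)) j).
Proof.
apply: (@measurable_wrt_psum (fun w => d0 w ^+ 2)).
apply: (@measurable_wrt_comp _ _ _ _ hF0 (fun y => y ^+ 2)) => //.
Qed.

Local Notation S n := (fun w => psum (fun i => d0 (iter i T w)) n).
Local Notation M n := (fun w => pmax (fun i => d0 (iter i T w)) n).
Local Notation V n := (fun w => qvar (fun i => d0 (iter i T w)) n).

Let mS n : measurable_fun setT (S n).
Proof. exact: (measurable_wrt_fun (FilP n) (measurable_wrt_psum F0d0 (leqnn n))). Qed.

Let mM n : measurable_fun setT (M n).
Proof. exact: (measurable_wrt_fun (FilP n) (measurable_wrt_pmax (leqnn n))). Qed.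

Let mV n : measurable_fun setT (V n).
Proof. exact: (measurable_wrt_fun (FilP n) (measurable_wrt_qvar (leqnn n))). Qed.

Let md n : measurable_fun setT (d n).
Proof. exact: (measurable_wrt_fun (FilP n) (@measurable_wrt_shift n _ F0d0)). Qed.

Let V0 n w : 0 <= V n w. Proof. exact: qvar_ge0. Qed.

Lemma qvar_add n k w : V (n + k) w = V n w + V k (iter n T w).
Proof.
elim: k => [|k IH]; first by rewrite addn0 /qvar [in X in _ + X]big_nil addr0.
by rewrite addnS !qvarS IH addrA -addnS addnC iterD.
Qed.

Lemma qvar_nd i n w : (i <= n)%N -> V i w <= V n w.
Proof. by move=> /subnKC <-; rewrite qvar_add lerDl. Qed.

Hypothesis hd0 : is_cond_exp P (filtration T Tinv F0 (-1)) d0 (cst 0).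
Hypothesis d0_int : P.-integrable setT (EFin \o d0).

(* Orthogonality of d to the past, split into positive and negative parts so that
   nonnegative weights can be inserted. *)
Lemma integral_mart_diff_parts n (A : set Omega) : Fil n A ->
  (\int[P]_(w in A) (Num.max (d n.+1 w) 0)%:E =
   \int[P]_(w in A) (Num.max (- d n.+1 w) 0)%:E)%E.
Proof.
move=> [B FB <-].
have FC : filtration T Tinv F0 (-1) (Tinv @^-1` B) by exists B.
(* Written as a preimage under T^(n+1) of a set of F_(-1), the event is carried by stationarity to
   the hypothesis on [d0]. *)
have AE : iter n T @^-1` B = iter n.+1 T @^-1` (Tinv @^-1` B).
  by apply/seteqP; split=> w /=; rewrite TK.
have mC : measurable (Tinv @^-1` B).
  by rewrite -[_ @^-1` _]setTI; apply: mTinv => //; exact: hF0.2.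
rewrite AE.
rewrite (@integral_iter_preimage n.+1 _ (fun w => Num.max (d0 w) 0))//; last 2 first.
- by apply: measurable_maxr => //; exact: (md 0).
- by move=> w; rewrite le_max lexx orbT.
rewrite (@integral_iter_preimage n.+1 _ (fun w => Num.max (- d0 w) 0))//; last 2 first.
- by apply: measurable_maxr => //; apply: measurableT_comp => //; exact: (md 0).
- by move=> w; rewrite le_max lexx orbT.
have [_ _ /(_ _ FC)] := hd0.
have d0B : P.-integrable (Tinv @^-1` B) (EFin \o d0).
  exact: (integrableS measurableT).
have posE : (\int[P]_(w in Tinv @^-1` B) (Num.max (d0 w) 0)%:E =
    \int[P]_(w in Tinv @^-1` B) ((EFin \o d0)^\+ w))%E.
  by apply: eq_integral => w _; rewrite funeposE EFin_max.
have negE : (\int[P]_(w in Tinv @^-1` B) (Num.max (- d0 w) 0)%:E =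
    \int[P]_(w in Tinv @^-1` B) ((EFin \o d0)^\- w))%E.
  by apply: eq_integral => w _; rewrite funenegE EFin_max.
rewrite integral0 integralE => /esym.
have pf := integrable_pos_fin_num mC d0B.
have nf := integrable_neg_fin_num mC d0B.
rewrite posE negE -(fineK pf) -(fineK nf) -EFinB => -[/eqP].
by rewrite subr_eq0 => /eqP ->.
Qed.

(** With [a], [b] the parts of [xi] and [f], [g] those of the increment, the parts of the product
    are af + bg and ag + bf. Under the weights [a] and [b], [f] and [g] have equal integrals, so the
    two parts do too; integrability makes their difference 0. *)
Lemma integral_mart_diff n (xi : Omega -> R) : measurable_wrt (Fil n) xi ->
  P.-integrable setT (fun w => (xi w * d n.+1 w)%:E) ->
  (\int[P]_w (xi w * d n.+1 w)%:E = 0)%E.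
Proof.
move=> Fxi xid.
pose pos (f : Omega -> R) w := Num.max (f w) 0.
have mpos f : measurable_fun setT f -> measurable_fun setT (pos f).
  by move=> mf; exact: measurable_maxr.
have pos0 f w : 0 <= pos f w by rewrite le_max lexx orbT.
have mxi : measurable_fun setT xi := measurable_wrt_fun (FilP n) Fxi.
have Fpos (f : Omega -> R) : measurable_wrt (Fil n) f -> measurable_wrt (Fil n) (pos f).
  by move=> Ff; apply: (measurable_wrt_max (FilP n)) => //; exact: measurable_wrt_cst.
have FNxi : measurable_wrt (Fil n) (\- xi).
  by apply: (@measurable_wrt_comp _ _ _ _ (FilP n) -%R); first exact: oppr_measurable.
pose f := pos (d n.+1); pose g := pos (\- d n.+1).
pose a := pos xi; pose b := pos (\- xi).
have mf : measurable_fun setT f by exact: mpos.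
have mg : measurable_fun setT g by apply: mpos; exact: measurableT_comp.
have ma : measurable_fun setT a by exact: mpos.
have mb : measurable_fun setT b by apply: mpos; exact: measurableT_comp.
have wE z : measurable_wrt (Fil n) z -> (forall w, 0 <= z w) ->
    (\int[P]_w (z w * f w)%:E = \int[P]_w (z w * g w)%:E)%E.
  move=> Fz z0; apply: (eq_integral_weight (FilP n)) => // [w|w|A FA].
  - exact: pos0.
  - exact: pos0.
  - exact: integral_mart_diff_parts.
have posE : (\int[P]_w ((fun w => (xi w * d n.+1 w)%:E)^\+ w) =
    \int[P]_w (a w * f w + b w * g w)%:E)%E.
  apply: eq_integral => w _; rewrite funeposE -EFin_max; congr EFin.
  by rewrite max_mulr0.
have negE : (\int[P]_w ((fun w => (xi w * d n.+1 w)%:E)^\- w) =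
    \int[P]_w (a w * g w + b w * f w)%:E)%E.
  apply: eq_integral => w _; rewrite funenegE -EFin_max; congr EFin.
  by rewrite -mulrN max_mulr0 opprK.
have nf := integrable_neg_fin_num measurableT xid.
rewrite integralE posE negE; move: nf; rewrite negE.
rewrite ge0_integralD_real//;
  do ?by [move=> w; rewrite mulr_ge0 ?pos0|exact: measurable_funM].
rewrite ge0_integralD_real//;
  do ?by [move=> w; rewrite mulr_ge0 ?pos0|exact: measurable_funM].
rewrite !wE//; do ?[exact: Fpos | move=> w; exact: pos0].
by move=> ?; rewrite subee.
Qed.

(** * Integrability and martingale transforms *)

Variable k : nat.
Hypothesis d0_fin : (\int[P]_w (`|d0 w| ^+ k.+2)%:E < +oo)%E.

Local Notation D n := (fun w => psum (fun i => `|d0 (iter i T w)|) n).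

Let F0norm : measurable_wrt F0 (fun w => `|d0 w|).
Proof.
by apply: (@measurable_wrt_comp _ _ _ _ hF0 Num.norm) => //; exact: normr_measurable.
Qed.

Let mD n : measurable_fun setT (D n).
Proof. exact: (measurable_wrt_fun (FilP n) (measurable_wrt_psum F0norm (leqnn n))). Qed.

Let D0 n w : 0 <= D n w. Proof. exact: psum_norm_ge0. Qed.

Lemma integral_psum_norm_fin n : (\int[P]_w (D n w ^+ k.+2)%:E < +oo)%E.
Proof.
elim: n => [|n IH].
  under eq_integral do rewrite psum0 expr0n/=.
  by rewrite integral0 ltry.
have mX j (h : Omega -> R) : measurable_fun setT h ->
  measurable_fun setT (fun w => h w ^+ j) by exact: measurable_funX.
have mnd : measurable_fun setT (fun w => `|d0 (iter n.+1 T w)|).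
  exact: (measurable_wrt_fun (FilP n.+1) (@measurable_wrt_shift n.+1 _ F0norm)).
apply: (@le_lt_trans _ _ (\int[P]_w (2 ^+ k.+1 *
    (D n w ^+ k.+2 + `|d0 (iter n.+1 T w)| ^+ k.+2))%:E)%E).
  apply: ge0_le_integral_real.
  - by apply: mX; exact: mD.
  - by apply: measurable_funM => //; apply: measurable_funD; exact: mX.
  - by move=> w; rewrite exprn_ge0.
  - by move=> w; rewrite psumS pow_add_le_convex.
rewrite ge0_integralZl_real; last 3 first.
- by apply: measurable_funD; apply: mX; rewrite //; exact: mD.
- by move=> w; rewrite addr_ge0// exprn_ge0.
- by rewrite exprn_ge0.
rewrite ge0_integralD_real; last 4 first.
- by apply: mX; exact: mD.
- exact: mX.
- by move=> w; rewrite exprn_ge0.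
- by move=> w; rewrite exprn_ge0.
rewrite (@integral_iter n.+1 (fun w => `|d0 w| ^+ k.+2))//.
- by apply: lte_mul_pinfty => //; exact: lte_add_pinfty.
- by apply: mX; exact: (measurable_wrt_fun hF0 F0norm).
Qed.

(** The summand 1 covers lower powers of [D n] where [D n] is small. *)
Lemma integrable_dominated n (f : Omega -> R) K : measurable_fun setT f ->
  (forall w, `|f w| <= K * (1 + D n w ^+ k.+2)) ->
  P.-integrable setT (fun w => (f w)%:E).
Proof.
move=> mf fK; have mX : measurable_fun setT (fun w => D n w ^+ k.+2).
  exact: measurable_funX.
apply: (@le_integrable _ _ _ P _ measurableT _
  (fun w => K%:E * (1 + (D n w ^+ k.+2)%:E))%E) => //.
- exact/measurable_EFinP.
- by move=> w _; rewrite -EFinD -EFinM lee_fin (le_trans (fK w))// ler_norm.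
apply: integrableZl => //; apply: integrableD => //.
  exact: finite_measure_integrable_cst.
apply/integrableP; split; first exact/measurable_EFinP.
under eq_integral do rewrite gee0_abs ?lee_fin ?exprn_ge0//.
exact: integral_psum_norm_fin.
Qed.

(** Turns pathwise inequalities into inequalities of expectations: each term of the transform has
    mean 0, and the bound by [K] supplies its integrability. *)
Lemma le_integral_mart_transform n (f g : Omega -> R) (xi : nat -> Omega -> R) K :
  measurable_fun setT f -> measurable_fun setT g ->
  (forall w, 0 <= f w) -> (forall w, 0 <= g w) ->
  (forall j, (j < n)%N -> measurable_wrt (Fil j) (xi j)) ->
  (forall j w, (j < n)%N -> `|xi j w * d j.+1 w| <= K * (1 + D n w ^+ k.+2)) ->
  (forall w, f w <= g w + \sum_(j < n) xi j w * d j.+1 w) ->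
  (\int[P]_w (f w)%:E <= \int[P]_w (g w)%:E)%E.
Proof.
move=> mf mg f0 g0 Fxi xiK fg.
have [gfin|] := boolP (\int[P]_w (g w)%:E < +oo)%E; last first.
  by rewrite -leNgt leye_eq => /eqP ->; rewrite leey.
have mxi j : (j < n)%N -> measurable_fun setT (fun w => xi j w * d j.+1 w).
  move=> jn; apply: measurable_funM; last exact: md.
  exact: (measurable_wrt_fun (FilP j) (Fxi j jn)).
have ixi (j : 'I_n) : P.-integrable setT (fun w => (xi j w * d j.+1 w)%:E).
  by apply: (@integrable_dominated n _ K) => [|w]; [exact: mxi|exact: xiK].
have gi : P.-integrable setT (fun w => (g w)%:E).
  apply/integrableP; split; first exact/measurable_EFinP.
  by under eq_integral do rewrite gee0_abs ?lee_fin//.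
apply: (@le_trans _ _ (\int[P]_w ((g w)%:E +
    \sum_(j < n) (xi j w * d j.+1 w)%:E))%E).
  apply: ge0_le_integral => //.
  - by move=> w _; rewrite lee_fin.
  - exact/measurable_EFinP.
  - apply: emeasurable_funD; first exact/measurable_EFinP.
    by apply: emeasurable_sum => j; apply/measurable_EFinP; exact: mxi.
  - by move=> w _; rewrite sumEFin -EFinD lee_fin.
rewrite integralD//; last exact: integrable_sum.
rewrite integral_sum// big1 ?adde0// => j _.
by apply: integral_mart_diff => //; exact: Fxi.
Qed.

(** The expansion of S_n^2 is an identity, so the transform can be used with either sign, giving
    both inequalities. The indicator of [B] is measurable at time 0 and does not spoil
    adaptedness. *)
Lemma integral_qvar_psum (B : set Omega) n : F0 B ->
  (\int[P]_(w in B) (S n w ^+ 2)%:E = \int[P]_(w in B) (V n w)%:E)%E.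
Proof.
move=> FB; have mB := hF0.2 _ FB.
have mI : measurable_fun setT (\1_B : Omega -> R).
  exact: measurable_indic.
have I0 w : 0 <= \1_B w :> R by rewrite indicE.
have mX : measurable_fun setT (fun w => S n w ^+ 2).
  exact: measurable_funX.
rewrite integral_indicM [RHS]integral_indicM.
have bnd s j w : `|s| <= 2 -> (j < n)%N ->
    `|s * (\1_B w * S j w) * d j.+1 w| <= 2 * (1 + D n w ^+ k.+2).
  move=> s2 jn; rewrite -mulrA normrM ler_pM//.
  apply: (@le_trans _ _ (D n w ^+ 2)).
    rewrite !normrM expr2 (ger0_norm (I0 w)).
    apply: ler_pM; rewrite ?mulr_ge0//; last exact: norm_le_psum_norm.
    apply: (@le_trans _ _ (1 * `|S j w|)).
      by rewrite ler_wpM2r// indicE; case: (_ \in _).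
    rewrite mul1r (le_trans (norm_psum_le _ _))//.
    by apply: psum_norm_nd; exact: ltnW.
  have [D1|D1] := leP (D n w) 1.
    rewrite (@le_trans _ _ 1) ?lerDl ?exprn_ge0//.
    by rewrite exprn_ile1.
  rewrite (@le_trans _ _ (D n w ^+ k.+2)) ?lerDr//.
  by rewrite ler_eXn2l.
have meas s j : (j < n)%N -> measurable_wrt (Fil j) (fun w => s * (\1_B w * S j w)).
  move=> jn; apply: (measurable_wrtM (FilP j)); first exact: measurable_wrt_cst.
  apply: (measurable_wrtM (FilP j)); last exact: measurable_wrt_psum.
  apply: measurable_wrt_indic; first exact: FilP.
  apply: (shifted_sigma_algebra_nd (leq0n j)); exists B => //.
have sq w := sqr_psum (fun i => d0 (iter i T w)) n.
apply/eqP; rewrite eq_le; apply/andP; split.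
- apply: (@le_integral_mart_transform n _ _ (fun j w => 2 * (\1_B w * S j w)) 2).
  + exact: measurable_funM.
  + exact: measurable_funM.
  + by move=> w; rewrite mulr_ge0// sqr_ge0.
  + by move=> w; rewrite mulr_ge0.
  + by move=> j jn; exact: meas.
  + by move=> j w jn; apply: bnd => //; rewrite ger0_norm.
  + move=> w; rewrite sq mulrDr lerD2l mulr_sumr; apply: ler_sum => j _.
    by rewrite le_eqVlt; apply/predU1P; left; ring.
- apply: (@le_integral_mart_transform n _ _ (fun j w => (- 2) * (\1_B w * S j w)) 2).
  + exact: measurable_funM.
  + exact: measurable_funM.
  + by move=> w; rewrite mulr_ge0.
  + by move=> w; rewrite mulr_ge0// sqr_ge0.
  + by move=> j jn; exact: meas.
  + by move=> j w jn; apply: bnd => //; rewrite normrN ger0_norm.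
  + move=> w; rewrite sq mulrDr -addrA lerDl mulr_sumr -big_split/=.
    apply: sumr_ge0 => j _.
    by rewrite le_eqVlt; apply/predU1P; left; ring.
Qed.

Hypothesis kE : k = (m.+1).*2.

Lemma integral_pmax_le_qvar n :
  (\int[P]_w (M n w ^+ (m.+2).*2)%:E <=
   ((2 ^+ (m.+2).*2 * ((m.+2).*2 ^ 2)%:R) ^+ m.+2)%:E *
   \int[P]_w (V n w ^+ m.+2)%:E)%E.
Proof.
have -> : (m.+2).*2 = k.+2 by rewrite kE.
set L := 2 ^+ k.+2 * _.
have L0 : 0 <= L by rewrite mulr_ge0// exprn_ge0.
rewrite -ge0_integralZl_real; last 3 first.
- exact: measurable_funX.
- by move=> w; rewrite exprn_ge0.
- by rewrite exprn_ge0.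
apply: (@le_integral_mart_transform n _ _ (fun j w =>
  k.+2%:R * (2 ^+ k.+2 * S j w ^+ k.+1 - 2 * (M j w ^+ k.+1 * Num.sg (S j w))))
  (k.+2%:R * (2 ^+ k.+2 + 2))).
- exact: measurable_funX.
- by apply: measurable_funM => //; exact: measurable_funX.
- by move=> w; rewrite exprn_ge0// pmax_ge0.
- by move=> w; rewrite mulr_ge0// exprn_ge0.
- move=> j jn.
  have FS : measurable_wrt (Fil j) (S j) by exact: measurable_wrt_psum.
  have FM : measurable_wrt (Fil j) (M j) by exact: measurable_wrt_pmax.
  have FX h : measurable_wrt (Fil j) h -> measurable_wrt (Fil j) (fun w => h w ^+ k.+1).
    by move=> Fh; exact: (@measurable_wrt_comp _ _ _ _ (FilP j) (fun y => y ^+ k.+1)).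
  have Fcst r := @measurable_wrt_cst _ _ _ _ (FilP j) r.
  apply: (measurable_wrtM (FilP j)) => //.
  apply: (measurable_wrtD (FilP j)).
    by apply: (measurable_wrtM (FilP j)) => //; exact: FX.
  apply: (@measurable_wrt_comp _ _ _ _ (FilP j) -%R); first exact: oppr_measurable.
  apply: (measurable_wrtM (FilP j)) => //; apply: (measurable_wrtM (FilP j)).
    exact: FX.
  by apply: (@measurable_wrt_comp _ _ _ _ (FilP j) Num.sg) => //; exact: measurable_sgr.
- move=> j w jn.
  have Dj : D j w <= D n w by apply: psum_norm_nd; exact: ltnW.
  have SD : `|S j w| <= D n w by apply: le_trans Dj; exact: norm_psum_le.
  have MD : `|M j w| <= D n w.
    by rewrite ger0_norm ?pmax_ge0//; apply: le_trans Dj; exact: pmax_le_psum_norm.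
  have dD : `|d j.+1 w| <= D n w.
    exact: (@norm_le_psum_norm _ (fun i => d0 (iter i T w))).
  have SX : `|S j w ^+ k.+1| <= D n w ^+ k.+1 by rewrite normrX lerXn2r ?nnegrE.
  have MX : `|M j w ^+ k.+1 * Num.sg (S j w)| <= D n w ^+ k.+1.
    rewrite normrM normrX normr_sg.
    rewrite (@le_trans _ _ (`|M j w| ^+ k.+1 * 1))//.
      by rewrite ler_wpM2l ?exprn_ge0//; case: (_ != _).
    by rewrite mulr1 lerXn2r ?nnegrE.
  rewrite normrM normrM normr_nat -[leLHS]mulrA -[leRHS]mulrA ler_wpM2l//.
  apply: (@le_trans _ _ ((2 ^+ k.+2 + 2) * (D n w ^+ k.+1 * D n w))).
    rewrite [leRHS]mulrA ler_pM// [leRHS]mulrDl.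
    apply: (le_trans (ler_normB _ _)); apply: lerD.
      rewrite (normrM (2 ^+ k.+2)); apply: ler_pM => //.
      by rewrite ger0_norm// exprn_ge0.
    by rewrite (normrM 2); apply: ler_pM => //; rewrite ger0_norm.
  by rewrite -exprSr ler_wpM2l ?addr_ge0 ?exprn_ge0// lerDr.
- move=> w; have := pathwise_BDG (fun i => d0 (iter i T w)) m n.
  by rewrite -[(m.+2).*2]/(m.+1.*2.+2) -kE exprMn.
Qed.

(** * Conditional second moments and the doubling step *)

Variable Z : nat -> Omega -> R.
Hypothesis hZ : forall n, is_cond_exp P F0 (fun w => S n w ^+ 2) (Z n).

Let F0Z n : measurable_wrt F0 (fun w => `|Z n w|).
Proof.
apply: (@measurable_wrt_comp _ _ _ _ hF0 Num.norm); first exact: normr_measurable.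
by have [] := hZ n.
Qed.

Let mZ n : measurable_fun setT (fun w => `|Z n w|).
Proof. exact: (measurable_wrt_fun hF0 (F0Z n)). Qed.

(* The version Z n of the conditional expectation is only almost everywhere
   nonnegative, hence the absolute value. *)
Lemma integral_norm_cond_exp n (B : set Omega) : F0 B ->
  (\int[P]_(w in B) `|Z n w|%:E = \int[P]_(w in B) (V n w)%:E)%E.
Proof.
move=> FB; have [FZ iZ ZS] := hZ n.
have F0I A A' : F0 A -> F0 A' -> F0 (A `&` A').
  have /measurable_g_measurableTypeE E := hF0.1.
  by rewrite -E; exact: measurableI.
(* This set is in [F0], so on its intersection with [B] the integrals of [V n] and [Z n] coincide;
   one is nonnegative and the other nonpositive, hence both are 0. *)
pose N := Z n @^-1` [set` `]-oo, 0[].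
pose N' := Z n @^-1` [set` `[0, +oo[].
have FN : F0 N by apply: FZ; exact: measurable_itv.
have FN' : F0 N' by apply: FZ; exact: measurable_itv.
have BE : B = (B `&` N) `|` (B `&` N').
  rewrite -setIUr; apply/seteqP; split=> [w Bw|w []//]; split=> //.
  by rewrite /N /N' /= !in_itv/= andbT; case: (ltP (Z n w) 0); [left|right].
have dis : [disjoint (B `&` N) & (B `&` N')].
  apply/disj_setPS => w [[_ +] [_ +]]; rewrite /N /N' /= !in_itv/= andbT.
  by move=> /lt_le_trans h /h; rewrite ltxx.
have split_int (f : Omega -> R) : measurable_fun setT f -> (forall w, 0 <= f w) ->
    (\int[P]_(w in B) (f w)%:E = \int[P]_(w in B `&` N) (f w)%:E +
      \int[P]_(w in B `&` N') (f w)%:E)%E.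
  move=> mf f0; rewrite {1}BE ge0_integral_setU//.
  - exact/hF0.2/F0I.
  - exact/hF0.2/F0I.
  - by apply/measurable_EFinP; exact: (@measurable_funS _ _ _ _ setT).
  - by move=> w _; rewrite lee_fin.
rewrite !split_int//; congr (_ + _)%E; last first.
  rewrite -integral_qvar_psum ?ZS//; do ?exact: F0I.
  rewrite -ZS; last exact: F0I.
  apply: eq_integral => w /set_mem [_]; rewrite /N' /= in_itv/= andbT => Zw.
  by rewrite ger0_norm.
have BN0 : (\int[P]_(w in B `&` N) (V n w)%:E = 0)%E.
  apply/eqP; rewrite eq_le integral_ge0 ?andbT; last first.
    by move=> w _; rewrite lee_fin.
  rewrite -integral_qvar_psum; last exact: F0I.
  rewrite -ZS; last exact: F0I.
  rewrite -oppe_ge0 -integralN; last first.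
    apply: integrable_add_def; first exact/hF0.2/F0I.
    by apply: (integrableS measurableT) => //; exact/hF0.2/F0I.
  apply: integral_ge0 => w [_]; rewrite /N /= in_itv/= => Zw.
  by rewrite lee_fin oppr_ge0 ltW.
rewrite BN0.
have := BN0; rewrite -integral_qvar_psum; last exact: F0I.
rewrite -ZS; last exact: F0I.
move=> Z0; rewrite -[RHS]oppe0 -Z0 -integralN; last first.
  apply: integrable_add_def; first exact/hF0.2/F0I.
  by apply: (integrableS measurableT) => //; exact/hF0.2/F0I.
apply: eq_integral => w /set_mem [_]; rewrite /N /= in_itv/= => Zw.
by rewrite ltr0_norm.
Qed.

Lemma integral_norm_cond_exp_shift n j (A : set Omega) : Fil n A ->
  (\int[P]_(w in A) `|Z j (iter n T w)|%:E =
   \int[P]_(w in A) (V j (iter n T w))%:E)%E.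
Proof.
move=> [B FB <-].
rewrite (@integral_iter_preimage n B (fun w => `|Z j w|))//; last exact: hF0.2.
rewrite (@integral_iter_preimage n B (V j))//; last exact: hF0.2.
exact: integral_norm_cond_exp.
Qed.

Let mVX n j : measurable_fun setT (fun w => V n w ^+ j).
Proof. exact: measurable_funX. Qed.

Let mZX n j : measurable_fun setT (fun w => `|Z n w| ^+ j).
Proof. exact: measurable_funX. Qed.

Let ZX0 n j w : 0 <= `|Z n w| ^+ j. Proof. exact: exprn_ge0. Qed.

Lemma integral_qvar_pow_fin n : (\int[P]_w (V n w ^+ m.+2)%:E < +oo)%E.
Proof.
apply: (le_lt_trans _ (integral_psum_norm_fin n)).
apply: ge0_le_integral_real => //.
- exact: measurable_funX.
- by move=> w; rewrite exprn_ge0.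
- move=> w; rewrite kE -[(m.+1.*2).+2]/((m.+2).*2) -mul2n exprM.
  by rewrite lerXn2r ?nnegrE ?exprn_ge0// qvar_le_psum_norm.
Qed.

Lemma integral_cond_exp_pow_fin n : (\int[P]_w (`|Z n w| ^+ m.+2)%:E < +oo)%E.
Proof.
apply: (le_lt_trans _ (integral_qvar_pow_fin n)).
apply: (le_integral_cond_exp_pow m.+1 hF0) => // B FB.
by rewrite integral_norm_cond_exp.
Qed.

(** V_j <= V_2i = V_i + V_i o T^i pathwise, which yields |Z_j| <= E_0(|Z_i| + |Z_i| o T^i) in
    integrated form; Jensen, convexity and stationarity conclude. Monotonicity in the index comes
    from V and is not visible on S. *)
Lemma integral_cond_exp_pow_double i j : (j <= i.*2)%N ->
  (\int[P]_w (`|Z j w| ^+ m.+2)%:E <=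
   (2 ^+ m.+2)%:E * \int[P]_w (`|Z i w| ^+ m.+2)%:E)%E.
Proof.
move=> ji; pose Zi' w := `|Z i (iter i T w)|.
have mZi' : measurable_fun setT Zi'.
  exact: (measurableT_comp (mZ i) (measurable_iter i)).
have Zi'0 w : 0 <= Zi' w by exact: normr_ge0.
have mZi'X l : measurable_fun setT (fun w => Zi' w ^+ l) by exact: measurable_funX.
apply: (@le_trans _ _ (\int[P]_w ((`|Z i w| + Zi' w) ^+ m.+2)%:E)%E).
  apply: (le_integral_cond_exp_pow m.+1 hF0) => //.
  - exact: measurable_funD.
  - by move=> w; rewrite addr_ge0 ?normr_ge0.
  move=> B FB; have mB := hF0.2 _ FB.
  have mI : measurable_fun setT (\1_B : Omega -> R) by exact: measurable_indic.
  rewrite integral_norm_cond_exp//.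
  apply: (@le_trans _ _ (\int[P]_(w in B) (V i w + V i (iter i T w))%:E)%E).
    rewrite integral_indicM [leRHS]integral_indicM.
    apply: ge0_le_integral_real.
    - exact: measurable_funM.
    - apply: measurable_funM => //; apply: measurable_funD => //.
      exact: (measurableT_comp (mV i) (measurable_iter i)).
    - by move=> w; rewrite mulr_ge0// indicE.
    - move=> w; rewrite ler_wpM2l ?indicE// -qvar_add addnn.
      exact: qvar_nd.
  under eq_integral do rewrite EFinD.
  under [leRHS]eq_integral do rewrite EFinD.
  have mfun (h : Omega -> R) : measurable_fun setT h ->
      measurable_fun B (fun w => (h w)%:E).
    by move=> mh; apply/measurable_EFinP; exact: (@measurable_funS _ _ _ _ setT).
  rewrite ge0_integralD//; do ?by [exact: (mfun _ (mV i))|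
    exact: (mfun _ (measurableT_comp (mV i) (measurable_iter i)))|
    move=> w _; rewrite lee_fin].
  rewrite ge0_integralD//;
    do ?by [exact: (mfun _ (mZ i))|exact: (mfun _ mZi')|move=> w _; rewrite lee_fin].
  (* Tower property: a set of F_0 also belongs to F_i. *)
  rewrite integral_norm_cond_exp// integral_norm_cond_exp_shift//.
  by apply: (shifted_sigma_algebra_nd (leq0n i)); exists B.
apply: (@le_trans _ _
    (\int[P]_w (2 ^+ m.+1 * (`|Z i w| ^+ m.+2 + Zi' w ^+ m.+2))%:E)%E).
  apply: ge0_le_integral_real.
  - by apply: measurable_funX; exact: measurable_funD.
  - by apply: measurable_funM => //; exact: measurable_funD.
  - by move=> w; rewrite exprn_ge0// addr_ge0.
  - by move=> w; exact: pow_add_le_convex.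
rewrite ge0_integralZl_real; last 3 first.
- exact: measurable_funD.
- by move=> w; rewrite addr_ge0// exprn_ge0.
- by rewrite exprn_ge0.
rewrite ge0_integralD_real//; last by move=> w; rewrite exprn_ge0.
rewrite (@integral_iter i (fun w => `|Z i w| ^+ m.+2))//.
have fin : (\int[P]_w (`|Z i w| ^+ m.+2)%:E \is a fin_num)%E.
  rewrite ge0_fin_numE; first exact: integral_cond_exp_pow_fin.
  by apply: integral_ge0 => w _; rewrite lee_fin.
rewrite -(fineK fin) -EFinD -!EFinM lee_fin.
by rewrite (exprS 2 m.+1) -mulr2n mulrnAr -mulr_natl mulrA.
Qed.

Lemma integral_qvar_double n (u be : R) : 0 <= u -> 0 <= be ->
  (\int[P]_w (V n w ^+ m.+2)%:E <= (u ^+ (m.+2 * m.+1))%:E)%E ->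
  (\int[P]_w (`|Z n w| ^+ m.+2)%:E <= (be ^+ (m.+2 * m.+1))%:E)%E ->
  (\int[P]_w (V (n + n) w ^+ m.+2)%:E <=
   (2 * (u + (m.+2 * 2 ^ m.+1)%:R * be) ^+ (m.+2 * m.+1))%:E)%E.
Proof.
move=> u0 be0 Vu Zbe.
set c := (m.+2 * 2 ^ m.+1)%:R.
pose V' w := V n (iter n T w); pose Z' w := `|Z n (iter n T w)|.
have mV' : measurable_fun setT V'.
  exact: (measurableT_comp (mV n) (measurable_iter n)).
have mZ' : measurable_fun setT Z'.
  exact: (measurableT_comp (mZ n) (measurable_iter n)).
have mV'X l : measurable_fun setT (fun w => V' w ^+ l) by exact: measurable_funX.
have V'0 w : 0 <= V' w by exact: V0.
have Z'0 w : 0 <= Z' w by exact: normr_ge0.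
have VX0 l w : 0 <= V n w ^+ l by exact: exprn_ge0.
have V'X0 l w : 0 <= V' w ^+ l by exact: exprn_ge0.
have V'u : (\int[P]_w (V' w ^+ m.+2)%:E <= (u ^+ (m.+2 * m.+1))%:E)%E.
  by rewrite (@integral_iter n (fun w => V n w ^+ m.+2)).
have Z'be : (\int[P]_w (Z' w ^+ m.+2)%:E <= (be ^+ (m.+2 * m.+1))%:E)%E.
  by rewrite (@integral_iter n (fun w => `|Z n w| ^+ m.+2)).
have X1 : (\int[P]_w (V n w ^+ m.+1 * V' w)%:E <= ((u ^+ m.+1 * be) ^+ m.+1)%:E)%E.
  rewrite -(@eq_integral_weight _ _ _ P _ (FilP n) Z' V' (fun w => V n w ^+ m.+1))//;
    last 2 first.
  - apply: (@measurable_wrt_comp _ _ _ _ (FilP n) (fun y => y ^+ m.+1)) => //.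
    exact: measurable_wrt_qvar.
  - by move=> A FA; exact: integral_norm_cond_exp_shift.
  have -> : (\int[P]_w (V n w ^+ m.+1 * Z' w)%:E =
      \int[P]_w (Z' w * V n w ^+ m.+1 * 1)%:E)%E.
    by apply: eq_integral => w _; rewrite mulr1 mulrC.
  have -> : (u ^+ m.+1 * be) ^+ m.+1 = be ^+ m.+1 * (u ^+ m.+1) ^+ m.+1.
    by rewrite exprMn mulrC.
  apply: hoelder_pow => //; rewrite ?exprn_ge0//.
  - by under eq_integral do rewrite mulr1; rewrite -exprM mulnC.
  - by under eq_integral do rewrite mulr1; rewrite -exprM mulnC.
(* Hoelder with density [V']: its two inputs are [X1] and the full moment of [V']. *)
have X2 : (\int[P]_w (V n w * V' w ^+ m.+1)%:E <=
    (u ^+ m.+1 * be * (u ^+ m.+2) ^+ m)%:E)%E.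
  have -> : (\int[P]_w (V n w * V' w ^+ m.+1)%:E =
      \int[P]_w (V n w * V' w ^+ m * V' w)%:E)%E.
    by apply: eq_integral => w _; rewrite exprSr mulrA.
  apply: hoelder_pow => //; rewrite ?exprn_ge0 ?mulr_ge0 ?exprn_ge0//.
  by under eq_integral do rewrite -exprSr; rewrite -exprM.
apply: (@le_trans _ _ (\int[P]_w (V n w ^+ m.+2 + V' w ^+ m.+2 +
    c * (V n w ^+ m.+1 * V' w + V n w * V' w ^+ m.+1))%:E)%E).
  apply: ge0_le_integral_real => //.
  - by apply: measurable_funD; [exact: measurable_funD|apply: measurable_funM => //;
      apply: measurable_funD; exact: measurable_funM].
  - by move=> w; rewrite exprn_ge0.
  - by move=> w; rewrite qvar_add; exact: pow_add_le.
have m1 : measurable_fun setT (fun w => V n w ^+ m.+1 * V' w).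
  exact: measurable_funM.
have m2 : measurable_fun setT (fun w => V n w * V' w ^+ m.+1).
  exact: measurable_funM.
have p1 w : 0 <= V n w ^+ m.+1 * V' w by exact: mulr_ge0.
have p2 w : 0 <= V n w * V' w ^+ m.+1 by exact: mulr_ge0.
rewrite ge0_integralD_real; last 4 first.
- exact: measurable_funD.
- by apply: measurable_funM => //; exact: measurable_funD.
- by move=> w; exact: addr_ge0.
- by move=> w; rewrite mulr_ge0// addr_ge0.
rewrite ge0_integralD_real// ge0_integralZl_real//; last 2 first.
- exact: measurable_funD.
- by move=> w; rewrite addr_ge0.
rewrite ge0_integralD_real//.
apply: (@le_trans _ _ ((u ^+ (m.+2 * m.+1))%:E + (u ^+ (m.+2 * m.+1))%:E +
   c%:E * (((u ^+ m.+1 * be) ^+ m.+1)%:E +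
     (u ^+ m.+1 * be * (u ^+ m.+2) ^+ m)%:E))%E).
  apply: leeD; first exact: leeD.
  by apply: lee_wpmul2l; [rewrite lee_fin ler0n|exact: leeD].
rewrite -!EFinD lee_fin.
have c1 : 1 <= c by rewrite ler1n muln_gt0/= expn_gt0.
have x0 : 0 <= c * be by rewrite mulr_ge0.
(* Each of the two copies of u^N is grouped with one mixed term, via N = (q-1)^2 + (q-1) and N =
   (N-1) + 1. Each group fits into one power of u + c be, whence the factor 2. *)
have h1 := pow_add_ge (m.+1 * m.+1) m u0 x0.
have h2 := pow_add_ge (m.+1 + m.+2 * m) 0 u0 x0.
have N1 : (m.+1 * m.+1 + m.+1 = m.+2 * m.+1)%N by rewrite -mulSnr.
have N2 : (m.+1 + m.+2 * m + 1 = m.+2 * m.+1)%N by rewrite addn1 mulnS addSn.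
rewrite N1 exprMn in h1; rewrite N2 expr1 in h2.
have h3 : c <= c ^+ m.+1 by rewrite ler_eXnr.
have h4 := ler_wpM2r (mulr_ge0 (exprn_ge0 (m.+1 * m.+1) u0) (exprn_ge0 m.+1 be0)) h3.
have -> : u ^+ m.+1 * be * u ^+ m.+2 ^+ m = u ^+ (m.+1 + m.+2 * m) * be.
  by rewrite exprD exprM mulrAC.
rewrite exprMn -exprM.
rewrite mulrDr [c * (u ^+ (m.+1 + _) * be)]mulrCA.
apply: (@le_trans _ _ ((u ^+ (m.+2 * m.+1) + u ^+ (m.+1 * m.+1) *
  (c ^+ m.+1 * be ^+ m.+1)) + (u ^+ (m.+2 * m.+1) + u ^+ (m.+1 + m.+2 * m) * (c * be)))).
  by rewrite [leLHS]addrACA lerD2r lerD2l [leRHS]mulrCA.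
by rewrite mulr_natl mulr2n; exact: lerD.
Qed.

(** * From powers of 2 to all n *)

Let N := (m.+2 * m.+1)%N.
Let c : R := (m.+2 * 2 ^ m.+1)%:R.
Let W n := fine (\int[P]_w (V n w ^+ m.+2)%:E).
Let b n := fine (\int[P]_w (`|Z n w| ^+ m.+2)%:E) `^ m.+2%:R^-1.

Let WE n : (\int[P]_w (V n w ^+ m.+2)%:E = (W n)%:E)%E.
Proof.
rewrite fineK// ge0_fin_numE; first exact: integral_qvar_pow_fin.
by apply: integral_ge0 => w _; rewrite lee_fin exprn_ge0.
Qed.

Let bE n : (\int[P]_w (`|Z n w| ^+ m.+2)%:E = (b n ^+ m.+2)%:E)%E.
Proof.
have I0 : (0 <= \int[P]_w (`|Z n w| ^+ m.+2)%:E)%E.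
  by apply: integral_ge0 => w _; rewrite lee_fin.
rewrite -powR_mulrn ?powR_ge0// -powRrM mulVf ?pnatr_eq0// powRr1 ?fine_ge0//.
by rewrite fineK// ge0_fin_numE// integral_cond_exp_pow_fin.
Qed.

Lemma Lnorm_cond_exp n : ('N[P]_(m.+2%:R%:E)[EFin \o Z n] = (b n)%:E)%E.
Proof.
rewrite unlock /= (eq_integral (fun w => (`|Z n w| ^+ m.+2)%:E)).
  rewrite bE poweR_EFin -powR_mulrn ?powR_ge0// -powRrM divff ?pnatr_eq0//.
  by rewrite powRr1 ?powR_ge0.
by move=> w _; rewrite /= powR_mulrn.
Qed.

(** In the constant, 2 comes from rounding [n] up to a power of 2, 2^N from splitting the N-th power
    of a sum, [c] from the doubling step and 4 from replacing the dyadic sum by the full one. The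
    factor (4c)^N >= 1 is put on the other term as well. *)
Lemma integral_qvar_pow_le n : (0 < n)%N ->
  (\int[P]_w (V n w ^+ m.+2)%:E <=
   (2 * 2 ^+ N * (4 * c) ^+ N)%:E *
   (n%:R%:E * \int[P]_w (`|d0 (T w)| ^+ (m.+2).*2)%:E + n%:R%:E *
     (\sum_(1 <= i < n.+1) (i%:R `^ (1 + N%:R^-1))^-1%:E *
       'N[P]_(m.+2%:R%:E)[EFin \o Z i] `^ m.+1%:R^-1) `^ N%:R))%E.
Proof.
move=> n0.
have b0 k' : 0 <= b k' by exact: powR_ge0.
have W0 k' : 0 <= W k'.
  by rewrite -lee_fin -WE; apply: integral_ge0 => w _; rewrite lee_fin exprn_ge0.
have c1 : 1 <= c by rewrite ler1n muln_gt0/= expn_gt0.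
have W1 : (\int[P]_w (`|d0 (T w)| ^+ (m.+2).*2)%:E = (W 1)%:E)%E.
  rewrite -WE; apply: eq_integral => w _.
  by rewrite /qvar big_nat1 -exprM mul2n -normrX ger0_norm// exprn_even_ge0//= odd_double.
have WS l u be : 0 <= u -> 0 <= be -> W (2 ^ l) <= u ^+ N ->
    b (2 ^ l) ^+ m.+2 <= be ^+ N -> W (2 ^ l.+1) <= 2 * (u + c * be) ^+ N.
  move=> u0 be0 Wu bbe; rewrite -lee_fin -WE expnS mul2n -addnn.
  by apply: integral_qvar_double => //; rewrite ?WE ?bE lee_fin.
have b_double j i : (0 < i)%N -> (j <= i.*2)%N -> b j <= 2 * b i.
  move=> _ /integral_cond_exp_pow_double.
  rewrite !bE -EFinM -exprMn lee_fin => h.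
  by rewrite -(@ler_pXn2r _ m.+2)// nnegrE ?mulr_ge0.
pose t i := (i%:R `^ (1 + N%:R^-1))^-1 * b i `^ m.+1%:R^-1.
have t0 i : 0 <= t i by rewrite mulr_ge0 ?invr_ge0 ?powR_ge0.
pose Lam := \sum_(1 <= i < n.+1) t i.
have Lam0 : 0 <= Lam by exact: sumr_ge0.
rewrite W1 (_ : (\sum_(1 <= i < n.+1) _)%E = Lam%:E); last first.
  rewrite /Lam -sumEFin; apply: eq_bigr => i _.
  by rewrite Lnorm_cond_exp poweR_EFin.
rewrite poweR_EFin powR_mulrn// WE -!EFinM lee_fin.
(* The least r with n <= 2^r: then 2^r <= 2n, and the last dyadic index used, 2^(r-1), does not
   exceed [n], so the full sum may stop at [n]. For n = 1 the dyadic sum is empty. *)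
pose r := up_log 2 n.
have nr : (n <= 2 ^ r)%N by exact: up_logP.
have r2n : (2 ^ r <= 2 * n)%N.
  have [n1|n1] := leqP n 1; first by rewrite /r (eqP (_ : n == 1%N)) ?eqn_leq ?n1.
  have := up_log_gtn (isT : (1 < 2)%N) n1; rewrite -/r.
  have : (0 < r)%N by rewrite up_log_gt0.
  by case: (r) => // r' _ /= /ltnW h; rewrite expnS leq_mul2l.
have sum_le : \sum_(l < r) (2 `^ N%:R^-1) ^- l * b (2 ^ l) `^ m.+1%:R^-1 <= 4 * Lam.
  have [n1|n1] := leqP n 1.
    by rewrite /r (eqP (_ : n == 1%N)) ?eqn_leq ?n1// up_log1 big_ord0 mulr_ge0.
  have := up_log_gtn (isT : (1 < 2)%N) n1; rewrite -/r.
  have : (0 < r)%N by rewrite up_log_gt0.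
  case: (r) => // r' _ /= rn.
  apply: (le_trans (dyadic_sum_le m b0 b_double r')); rewrite ler_wpM2l//.
  rewrite /Lam (@big_cat_nat _ _ _ (2 ^ r').+1 1 n.+1)//=; last by rewrite ltnS ltnW.
  by rewrite lerDl sumr_ge0.
have W_nd : W n <= W (2 ^ r).
  rewrite -lee_fin -!WE; apply: ge0_le_integral_real => // w.
    by rewrite exprn_ge0.
  by rewrite lerXn2r ?nnegrE// qvar_nd.
have rec := @dyadic_recursion _ m c (W 1) (fun l => W (2 ^ l)) b
  (le_trans ler01 c1) (W0 1) b0 (lexx _) WS r.
apply: (le_trans W_nd); apply: (le_trans rec).
set s := \sum_(l < r) _.
have s0 : 0 <= s.
  apply: sumr_ge0 => l _.
  by rewrite mulr_ge0 ?powR_ge0// invr_ge0 exprn_ge0 ?powR_ge0.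
have cs0 : 0 <= c * s by rewrite mulr_ge0// (le_trans ler01).
have p1 : (W 1 `^ N%:R^-1 + c * s) ^+ N <= 2 ^+ N * (W 1 + (4 * c) ^+ N * Lam ^+ N).
  apply: (@le_trans _ _ (2 ^+ N * ((W 1 `^ N%:R^-1) ^+ N + (c * s) ^+ N))).
    apply: (le_trans (pow_add_le_convex N.-1 (powR_ge0 _ _) cs0)).
    rewrite ler_wpM2r ?addr_ge0 ?exprn_ge0 ?powR_ge0//.
    by rewrite ler_eXn2l ?ltr1n.
  rewrite ler_wpM2l ?exprn_ge0// -powR_mulrn ?powR_ge0// -powRrM mulVf ?pnatr_eq0//.
  rewrite powRr1// lerD2l -exprMn lerXn2r ?nnegrE//.
    by rewrite !mulr_ge0// (le_trans ler01).
  by rewrite [4 * c]mulrC -mulrA ler_wpM2l// (le_trans ler01).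
have c4 : 1 <= (4 * c) ^+ N by rewrite exprn_ege1//; lra.
apply: (@le_trans _ _ (2 * n%:R * (2 ^+ N * (W 1 + (4 * c) ^+ N * Lam ^+ N)))).
  apply: ler_pM; rewrite ?exprn_ge0 ?addr_ge0 ?powR_ge0//.
  by rewrite -natrX -natrM ler_nat.
rewrite -mulrDr.
have -> : 2 * 2 ^+ N * (4 * c) ^+ N * (n%:R * (W 1 + Lam ^+ N)) =
  2 * n%:R * (2 ^+ N * ((4 * c) ^+ N * W 1 + (4 * c) ^+ N * Lam ^+ N)) by ring.
by rewrite ler_wpM2l ?mulr_ge0// ler_wpM2l ?exprn_ge0// lerD2r ler_peMl.
Qed.

End StationaryMartingale.

Theorem theorem14 (R : realType) (p : nat) (p_ge4 : (4 <= p)%N)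
    (p_even : ~~ odd p) :
  exists C : R,
    forall (disp : measure_display) (Omega : measurableType disp)
      (P : probability Omega R) (T Tinv : Omega -> Omega)
      (F0 : set (set Omega)) (d0 : Omega -> R) (E0S2 : nat -> Omega -> R),
    cancel T Tinv ->
    cancel Tinv T ->
    measurable_fun setT T -> measurable_fun setT Tinv ->
    (forall A : set Omega, measurable A -> P (T @^-1` A) = P A) ->
    is_sub_sigma_algebra F0 ->
    F0 `<=` filtration T Tinv F0 1 ->
    d0 \in Lfun P (p%:R)%:E ->
    measurable_wrt F0 d0 ->
    is_cond_exp P (filtration T Tinv F0 (-1)) d0 (cst 0) ->
    (forall k : nat,
      is_cond_exp P F0 (fun w => partial_sum T d0 k w ^+ 2) (E0S2 k)) ->
    forall n : nat, (0 < n)%N ->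
    ('E_P[fun w =>
        (\big[Num.max/0%R]_(1 <= j < n.+1) `|partial_sum T d0 j w| ^+ p)%R]
     <= C%:E *
        (n%:R%:E * 'E_P[fun w => (`|d0 (T w)| ^+ p)%R]
         + n%:R%:E *
           (\sum_(1 <= k < n.+1)
              (k%:R `^ (1 + 4 / (p%:R * (p%:R - 2))))^-1%:E *
              'N[P]_((p%:R / 2)%:E)[EFin \o E0S2 k] `^ (2 / (p%:R - 2)))
           `^ (p%:R * (p%:R - 2) / 4)))%E.
Proof.
have [m pE] : exists m, p = m.+2.*2.
  have := odd_double_half p; rewrite (negbTE p_even) add0n => pE.
  move: p_ge4; rewrite -[X in (_ <= X)%N]pE (leq_double 2).
  by case: (p./2) pE => [|[|h]] // <- _; exists h.
(* The constant of the maximal inequality times that of the bound on E V_n^q. *)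
exists ((2 ^+ (m.+2).*2 * ((m.+2).*2 ^ 2)%:R) ^+ m.+2 *
  (2 * 2 ^+ (m.+2 * m.+1) * (4 * (m.+2 * 2 ^ m.+1)%:R) ^+ (m.+2 * m.+1))).
move=> disp Omega P T Tinv F0 d0 E0S2 TK _ mT mTinv PT hF0 F0T d0p F0d0 hd0 hE n n0.
have q_neq0 : m.+2%:R != 0 :> R by rewrite pnatr_eq0.
have q1_neq0 : m.+1%:R != 0 :> R by rewrite pnatr_eq0.
have pR : p%:R = 2 * m.+2%:R :> R by rewrite pE -muln2 natrM mulrC.
have qR : m.+2%:R = m.+1%:R + 1 :> R by rewrite natr1.
have y2 (y : R) : y != 0 -> 2 * (y + 1) - 2 != 0.
  by move=> y0; rewrite (_ : _ - _ = 2 * y) ?mulf_neq0//; ring.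
have e1 : p%:R / 2 = m.+2%:R :> R by rewrite pR; field.
have e2 : 1 + 4 / (p%:R * (p%:R - 2)) = 1 + (m.+2 * m.+1)%:R^-1 :> R.
  rewrite natrM pR; move: q_neq0 q1_neq0; rewrite qR.
  by move: m.+1%:R => y y1 y0; field; rewrite y0 y1 y2.
have e3 : 2 / (p%:R - 2) = m.+1%:R^-1 :> R.
  by rewrite pR qR; move: m.+1%:R q1_neq0 => y y0; field; rewrite y0 y2.
have e4 : p%:R * (p%:R - 2) / 4 = (m.+2 * m.+1)%:R :> R.
  by rewrite natrM pR qR; field.
have d0_pow : P.-integrable setT (fun w => (`|d0 w| ^+ p)%:E).
  have p1 : 1 <= p%:R :> R by rewrite ler1n (leq_trans _ p_ge4).
  have := Lfun_integrable p1 d0p.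
  by apply: eq_integrable => // w _; rewrite powR_mulrn.
have d0_fin : (\int[P]_w (`|d0 w| ^+ p)%:E < +oo)%E.
  have /integrableP[_] := d0_pow.
  by under eq_integral do rewrite gee0_abs ?lee_fin ?exprn_ge0//.
have md0 : measurable_fun setT d0 := measurable_wrt_fun hF0 F0d0.
have d0_int : P.-integrable setT (EFin \o d0).
  apply: (@le_integrable _ _ _ P _ measurableT _
    (fun w => (1 + (`|d0 w| ^+ p)%:E)%E)) => //.
  - exact/measurable_EFinP.
  - move=> w _; rewrite -EFinD lee_fin [leRHS]ger0_norm ?addr_ge0 ?exprn_ge0//.
    have [d1|d1] := leP `|d0 w| 1; first by rewrite (le_trans d1)// lerDl exprn_ge0.
    rewrite (@le_trans _ _ (`|d0 w| ^+ p))// ?lerDr//.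
    by rewrite ler_eXnr ?(ltW d1)// (leq_trans _ p_ge4).
  - by apply: integrableD => //; exact: finite_measure_integrable_cst.
have expE (f : Omega -> R) : ('E_P[f] = \int[P]_w (f w)%:E)%E by rewrite unlock.
rewrite !expE e1 e2 e3 e4 EFinM -muleA.
have pE2 : p = (m.+1.*2).+2 by rewrite pE.
rewrite (eq_integral
    (fun w => (pmax (fun i => d0 (iter i T w)) n ^+ (m.+2).*2)%:E)); last first.
  move=> w _; rewrite pE.
  exact: (congr1 EFin (bigmax_psum_pmax (fun i => d0 (iter i T w)) _ n)).
rewrite pE2 in d0_fin.
apply: (le_trans (integral_pmax_le_qvar
  TK mT mTinv PT hF0 F0T F0d0 hd0 d0_int d0_fin erefl n)).
apply: lee_wpmul2l.
  by rewrite lee_fin; do ?[exact: exprn_ge0|apply: exprn_ge0|apply: mulr_ge0].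
have := integral_qvar_pow_le TK mT mTinv PT hF0 F0T F0d0 hd0 d0_int d0_fin erefl hE n0.
by rewrite pE.
Qed.
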